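(* Let $\varphi$ be a Musielak–Orlicz function of uniformly lower type $p$ for some $p\in(0,\infty)$. If $\varphi\in\mathbb S^-$ and the stochastic basis is regular, then for every $r\in(0,1]$, $H^M_\varphi(\Omega)=H^{\varphi,\infty,M}_{\mathrm{at},r}(\Omega)$ and $H^S_\varphi(\Omega)=H^{\varphi,\infty,S}_{\mathrm{at},r}(\Omega)$ with equivalent quasi-norms.
   Context: Let $(\Omega,\mathcal F,\mathbb P)$ be a probability space, $(\mathcal F_n)_{n\in\mathbb Z_+}$ a nondecreasing sequence of sub-$\sigma$-algebras, $\mathbb E_n$ the conditional expectations. A Musielak–Orlicz function is $\varphi:\Omega\times[0,\infty)\to[0,\infty)$ with $\varphi(x,\cdot)$ nondecreasing, $\varphi(x,0)=0$, $\lim_{t\to\infty}\varphi(x,t)=\infty$ for each $x$, $\varphi(\cdot,t)$ measurable, positive and integrable for each $t$; $\varphi_n(\cdot,t):=\mathbb E_n\varphi(\cdot,t)$; $\|f\|_{L^\varphi(\Omega)}:=\inf\{\lambda>0:\int_\Omega\varphi(x,|f|/\lambda)\,d\mathbb P\le1\}$. Uniformly lower type $p$: $\varphi(x,st)\le Cs^p\varphi(x,t)$ for all $x$, $t\ge0$, $s\in(0,1)$. $\varphi\in\mathbb S^-$: there is $K$ with $K^{-1}\varphi_{n-1}(x,t)\le\varphi_n(x,t)$ for all $t\ge0$, $n\ge1$, a.e. $x$. Regular: there is $R$ with $f_n\le Rf_{n-1}$ for all $n\ge1$ and every nonnegative martingale. $\mathcal M$: martingales $f=(f_n)$ with $f_0=0$;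 $d_nf=f_n-f_{n-1}$; $S(f)=(\sum_{i\ge1}|d_if|^2)^{1/2}$; $M(f)=\sup_n|f_n|$; $H^M_\varphi(\Omega)=\{f\in\mathcal M:\|M(f)\|_{L^\varphi}<\infty\}$, $H^S_\varphi(\Omega)=\{f\in\mathcal M:\|S(f)\|_{L^\varphi}<\infty\}$ with these quasi-norms. For a stopping time $\nu$, $B_\nu=\{\nu<\infty\}$. For $T\in\{S,M\}$, a measurable $a$ is a $(\varphi,\infty)_T$-atom if there is a stopping time $\nu$ with (i) $\mathbb E_na=0$ whenever $\nu\ge n$, (ii) $\|T(a)\|_{L^\infty(B_\nu)}\le\|\mathbf 1_{B_\nu}\|_{L^\varphi}^{-1}$ (computed for the martingale $(\mathbb E_na)$). For $r>0$, $H^{\varphi,\infty,T}_{\mathrm{at},r}(\Omega)$ is the set of $f\in\mathcal M$ with $f_n=\sum_{k\in\mathbb Z}\mu^k\mathbb E_na^k$ for all $n$, where $\mu^k\ge0$ and $a^k$ are $(\varphi,\infty)_T$-atoms with stopping times $\nu^k$, such that $\|\{\sum_k[\mu^k\mathbf 1_{B_{\nu^k}}/\|\mathbf 1_{B_{\nu^k}}\|_{L^\varphi}]^r\}^{1/r}\|_{L^\varphi}<\infty$; the quasi-norm is the infimum of this over all decompositions. *)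

(* Defs.v *)
From HB Require Import structures.
From mathcomp Require Import all_boot all_order all_algebra.
From mathcomp Require Import all_classical all_reals all_analysis.
Set Implicit Arguments. Unset Strict Implicit. Unset Printing Implicit Defensive.
Import Order.TTheory GRing.Theory Num.Theory.
Import numFieldNormedType.Exports.
Local Open Scope classical_set_scope.
Local Open Scope ring_scope.

Section MartingaleHardy.
Context {d : measure_display} {T : measurableType d} {R : realType}.
Variable P : probability T R.

Definition Gmeasurable (G : set (set T)) (f : T -> R) :=
  forall B : set R, measurable B -> G (f @^-1` B).

Definition is_filtration (F : nat -> set (set T)) :=
  (forall n, sigma_algebra setT (F n)) /\
  (forall n, F n `<=` measurable) /\
  (forall n, F n `<=` F n.+1).

Definition is_condexp_op (F : nat -> set (set T)) (E : nat -> (T -> R) -> T -> R) :=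
  forall n (f : T -> R), P.-integrable setT (EFin \o f) ->
    [/\ Gmeasurable (F n) (E n f),
        P.-integrable setT (EFin \o E n f) &
        forall A, F n A ->
          (\int[P]_(x in A) (E n f x)%:E = \int[P]_(x in A) (f x)%:E)%E].

(** Musielak--Orlicz function (only values for t >= 0 are relevant) *)
Definition MO_function (phi : T -> R -> R) :=
  [/\ (forall x s t, 0 <= s -> s <= t -> phi x s <= phi x t) /\
      (forall x, phi x 0 = 0),
      (forall x, phi x t @[t --> +oo] --> +oo),
      (forall t, 0 <= t -> measurable_fun setT (fun x => phi x t)),
      (forall t, 0 < t -> forall x, 0 < phi x t) &
      (forall t, 0 <= t -> P.-integrable setT (fun x => (phi x t)%:E))].

Definition lower_type (phi : T -> R -> R) (p : R) :=
  exists C : R, 0 < C /\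
    forall x t s, 0 <= t -> 0 < s < 1 -> phi x (s * t) <= C * s `^ p * phi x t.

Definition phi_n (E : nat -> (T -> R) -> T -> R) (phi : T -> R -> R) n x t :=
  E n (fun y => phi y t) x.

Definition S_minus (E : nat -> (T -> R) -> T -> R) (phi : T -> R -> R) :=
  exists K : R, 0 < K /\
    forall n t, 0 <= t ->
      {ae P, forall x, K^-1 * phi_n E phi n x t <= phi_n E phi n.+1 x t}.

Definition martingale (F : nat -> set (set T)) (E : nat -> (T -> R) -> T -> R)
    (f : nat -> T -> R) :=
  (forall n, Gmeasurable (F n) (f n) /\ P.-integrable setT (EFin \o f n)) /\
  (forall n, {ae P, forall x, E n (f n.+1) x = f n x}).

Definition martingale0 F E (f : nat -> T -> R) :=
  martingale F E f /\ {ae P, forall x, f 0%N x = 0}.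

Definition regular (F : nat -> set (set T)) (E : nat -> (T -> R) -> T -> R) :=
  exists Rc : R, 0 < Rc /\
    forall f : nat -> T -> R, martingale F E f ->
      (forall n, {ae P, forall x, 0 <= f n x}) ->
      forall n, {ae P, forall x, f n.+1 x <= Rc * f n x}.

Definition phie (phi : T -> R -> R) (x : T) (y : \bar R) : \bar R :=
  match y with r%:E => (phi x r)%:E | _ => +oo%E end.

Definition Lphi_norm (phi : T -> R -> R) (g : T -> \bar R) : \bar R :=
  ereal_inf [set l%:E | l in
    [set l : R | 0 < l /\ (\int[P]_x phie phi x (g x * (l^-1)%:E) <= 1)%E]].

Definition Mf (f : nat -> T -> R) (x : T) : \bar R :=
  ereal_sup [set (`|f n x|)%:E | n in [set: nat]].

Definition Sf (f : nat -> T -> R) (x : T) : \bar R :=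
  ((\sum_(1 <= i <oo) ((f i x - f i.-1 x) ^+ 2)%:E) `^ (2^-1))%E.

(** stopping times, with None standing for +oo *)
Definition stopping_time (F : nat -> set (set T)) (nu : T -> option nat) :=
  forall n, F n [set x | exists2 k, (k <= n)%N & nu x = Some k].

Definition nu_ge (nu : T -> option nat) (n : nat) (x : T) : bool :=
  if nu x is Some k then (n <= k)%N else true.

Definition Bnu (nu : T -> option nat) : set T := [set x | nu x <> None].

Definition indic_e (B : set T) (x : T) : \bar R := (\1_B x)%:E.

(** (phi, oo)_Top-atoms, Top in {Mf, Sf} *)
Definition atom (F : nat -> set (set T)) (E : nat -> (T -> R) -> T -> R)
    (phi : T -> R -> R) (Top : (nat -> T -> R) -> T -> \bar R)
    (a : T -> R) (nu : T -> option nat) :=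
  [/\ measurable_fun setT a, P.-integrable setT (EFin \o a),
      stopping_time F nu,
      (forall n, {ae P, forall x, nu_ge nu n x -> E n a x = 0}) &
      {ae P, forall x, Bnu nu x ->
         (Top (fun n => E n a) x <= (Lphi_norm phi (indic_e (Bnu nu)))^-1)%E}].

(** f_n = sum_{k in Z} mu^k E_n a^k (a.e. limit of symmetric partial sums) *)
Definition atomic_decomp F E phi Top (f : nat -> T -> R)
    (mu : int -> R) (a : int -> T -> R) (nu : int -> T -> option nat) :=
  [/\ forall k, 0 <= mu k,
      forall k, atom F E phi Top (a k) (nu k) &
      forall n, {ae P, forall x,
        (\sum_(i < (2 * N).+1) mu (i%:Z - N%:Z) * E n (a (i%:Z - N%:Z)) x)
          @[N --> \oo] --> f n x}].

Definition atomic_value (phi : T -> R -> R) (r : R)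
    (mu : int -> R) (nu : int -> T -> option nat) : \bar R :=
  Lphi_norm phi (fun x =>
    ((\esum_(k in [set: int])
       (((mu k)%:E * indic_e (Bnu (nu k)) x
          * (Lphi_norm phi (indic_e (Bnu (nu k))))^-1) `^ r)) `^ (r^-1))%E).

(** atomic quasi-norm (infimum over all decompositions; +oo if none) *)
Definition at_norm F E phi Top (r : R) (f : nat -> T -> R) : \bar R :=
  ereal_inf [set v | exists mu a nu,
    atomic_decomp F E phi Top f mu a nu /\ v = atomic_value phi r mu nu].

End MartingaleHardy.

(* Main.v *)
(** Both Mf and Sf are suprema over n of seminorms of the first n terms of the martingale, and
    the two halves of the proof only use that.

    If f is an atomic sum, then Top f <= sum_k mu^k 1_{B_k} / ||1_{B_k}|| a.e., and for r <= 1 this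
    is at most the l^r sum.  Since phi need not be continuous in t, phi(x, Top f) need not be
    measurable, but the integral of a nonnegative function is a supremum over simple functions and
    hence still monotone.

    Conversely, let A_n be the event that the n-th seminorm is the first one above 2^k.  By
    regularity A_{n+1} lies a.e. in the F_n-measurable set {E_n 1_{A_{n+1}} >= 1/Rc}, so stopping on
    these sets happens before the level 2^k is passed.  The conditional expectation of 1_{A_{n+1}}
    can be moved to phi, and S^- allows to pass from phi_n to phi_{n+1}, whence
    int_{B_k} phi(., 2^k/lam) <= Rc K int_{Top f > 2^k} phi(., 2^k/lam), up to unions over higher
    levels.  Summing over k, the lower type makes both sides geometric, and gives
    int phi(., sup_k 2^k 1_{B_k} / lam) <= C int phi(., Top f / lam); the constant is absorbed by
    lower type.  The differences of f stopped at consecutive levels are L^2-bounded martingales,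
    hence closed, and their closing variables are multiples of atoms. *)

Require Import Defs.
From HB Require Import structures.
From mathcomp Require Import all_boot all_order all_algebra.
From mathcomp Require Import all_classical all_reals all_analysis.
From mathcomp Require Import finmap measurable_realfun.
From mathcomp Require Import zify lra ring.
Import Order.TTheory GRing.Theory Num.Theory.
Import numFieldNormedType.Exports.
Local Open Scope classical_set_scope.
Local Open Scope ring_scope.
Set Implicit Arguments.
Unset Strict Implicit.
Unset Printing Implicit Defensive.

(** * Integrals of nonnegative functions without measurability *)

Section lower_integral.
Context {d : measure_display} {T : measurableType d} {R : realType}.
Variable P : probability T R.
Import HBNNSimple.

(* The integral of a nonnegative function is a supremum over simple functions, so monotonicity
   needs no measurability. *)
Lemma ae_le_lower_integral (f g : T -> \bar R) :
  (forall x, 0 <= f x)%E -> (forall x, 0 <= g x)%E ->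
  {ae P, forall x, (f x <= g x)%E} ->
  (\int[P]_x f x <= \int[P]_x g x)%E.
Proof.
move=> f0 g0 [N [mN PN fgN]].
rewrite !ge0_integralTE//.
apply: ge_ereal_sup => _ [h /= hf <-].
(* The simple function [h] is set to 0 on the exceptional null set [N]: its integral does not
   change, and it now lies below [g] everywhere. *)
pose h' := proj_nnsfun h (measurableC mN).
have -> : sintegral P h = sintegral P h'.
  rewrite -!integralT_nnsfun; apply: ge0_ae_eq_integral => //.
  - exact/measurable_EFinP.
  - exact/measurable_EFinP.
  - by move=> x _; rewrite lee_fin.
  - by move=> x _; rewrite lee_fin.
  - exists N; split => // x; apply: contra_notP => Nx /= _.
    by rewrite /h' /proj_nnsfun /= mindicE mem_set// mulr1.
apply: ereal_sup_ubound; exists h' => //= x.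
rewrite /h' /proj_nnsfun /= mindicE; case: (boolP (x \in ~` N)) => xN.
  rewrite mulr1; apply: le_trans (hf x) _.
  by move: xN => /set_mem xN; apply: contrapT => nfg; apply: xN; exact: fgN.
by rewrite mulr0.
Qed.

Lemma le_lower_integral (f g : T -> \bar R) :
  (forall x, 0 <= f x)%E -> (forall x, f x <= g x)%E ->
  (\int[P]_x f x <= \int[P]_x g x)%E.
Proof.
move=> f0 fg; apply: ae_le_lower_integral => //; last exact: aeW.
by move=> x; exact: le_trans (fg x).
Qed.

End lower_integral.

(** * Functions measurable with respect to a sub-sigma-algebra *)

Section sub_sigma_algebra.
Context {d : measure_display} {T : measurableType d} {R : realType}.
Variables (P : probability T R) (G : set (set T)).
Hypotheses (sG : sigma_algebra setT G) (Gm : G `<=` measurable).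

(** A sigma-algebra coincides with the one it generates. This moves the question to the measurable
    type generated by [G], where the usual closure properties are available. *)
Lemma GmeasurableP (f : T -> R) :
  Gmeasurable G f <-> measurable_fun [set: g_sigma_algebraType G] f.
Proof.
split => [mf _ B mB|mf B mB].
  by rewrite setTI /measurable/= sigma_algebra_id//; exact: mf.
have := mf measurableT B mB.
by rewrite setTI /measurable/= sigma_algebra_id.
Qed.

Lemma Gmeasurable_fun (f : T -> R) : Gmeasurable G f -> measurable_fun setT f.
Proof. by move=> mf _ B mB; rewrite setTI; apply: Gm; exact: mf. Qed.

Lemma sub_measurableE (A : set T) :
  G A <-> measurable (A : set (g_sigma_algebraType G)).
Proof. by rewrite /measurable/= sigma_algebra_id. Qed.

Lemma Gmeasurable_cst (c : R) : Gmeasurable G (cst c).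
Proof. by apply/GmeasurableP; exact: measurable_cst. Qed.

Lemma GmeasurableD (f g : T -> R) :
  Gmeasurable G f -> Gmeasurable G g -> Gmeasurable G (f \+ g).
Proof. by move=> /GmeasurableP ? /GmeasurableP ?; apply/GmeasurableP; exact: measurable_funD. Qed.

Lemma GmeasurableB (f g : T -> R) :
  Gmeasurable G f -> Gmeasurable G g -> Gmeasurable G (f \- g).
Proof. by move=> /GmeasurableP ? /GmeasurableP ?; apply/GmeasurableP; exact: measurable_funB. Qed.

Lemma GmeasurableM (f g : T -> R) :
  Gmeasurable G f -> Gmeasurable G g -> Gmeasurable G (f \* g).
Proof. by move=> /GmeasurableP ? /GmeasurableP ?; apply/GmeasurableP; exact: measurable_funM. Qed.

Lemma Gmeasurable_indic (A : set T) : G A -> Gmeasurable G (\1_A : T -> R).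
Proof. by move=> /sub_measurableE GA; apply/GmeasurableP; exact: measurable_indic. Qed.

Lemma Gmeasurable_comp (h : R -> R) (f : T -> R) :
  measurable_fun setT h -> Gmeasurable G f -> Gmeasurable G (h \o f).
Proof. by move=> ? /GmeasurableP ?; apply/GmeasurableP; exact: measurableT_comp. Qed.

Lemma Gmeasurable_lt (f g : T -> R) :
  Gmeasurable G f -> Gmeasurable G g -> G [set x | f x < g x].
Proof.
move=> /GmeasurableP /measurable_EFinP mf /GmeasurableP /measurable_EFinP mg.
apply/sub_measurableE; under eq_set do rewrite -lte_fin.
by rewrite -[X in measurable X]setTI; exact: measurable_lte.
Qed.

Lemma Gmeasurable_le (f g : T -> R) :
  Gmeasurable G f -> Gmeasurable G g -> G [set x | f x <= g x].
Proof.
move=> /GmeasurableP mf /GmeasurableP mg; apply/sub_measurableE.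
by rewrite -[X in measurable X]setTI; exact: measurable_fun_le.
Qed.

Lemma sub_setC (A : set T) : G A -> G (~` A).
Proof. by move=> /sub_measurableE ?; apply/sub_measurableE; exact: measurableC. Qed.

Lemma sub_setI (A B : set T) : G A -> G B -> G (A `&` B).
Proof. by move=> /sub_measurableE ? /sub_measurableE ?; apply/sub_measurableE; exact: measurableI. Qed.

Lemma sub_setT : G setT.
Proof. exact/sub_measurableE. Qed.

Lemma sub_bigcup (A : nat -> set T) :
  (forall i, G (A i)) -> G (\bigcup_i A i).
Proof.
move=> GA; apply/sub_measurableE; apply: bigcup_measurable => i _.
exact/sub_measurableE.
Qed.

(* Domination on every set of the sub-sigma-algebra, in particular on [{v < u}], forces domination a.e. *)
Lemma ae_le_sub (u v : T -> R) :
  Gmeasurable G u -> Gmeasurable G v ->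
  P.-integrable setT (EFin \o u) -> P.-integrable setT (EFin \o v) ->
  (forall A, G A -> (\int[P]_(x in A) (u x)%:E <= \int[P]_(x in A) (v x)%:E)%E) ->
  {ae P, forall x, u x <= v x}.
Proof.
move=> Gu Gv iu iv uv.
pose A := [set x | v x < u x].
have GA : G A by exact: Gmeasurable_lt.
have mA : measurable A by exact: Gm.
have iuA : P.-integrable A (EFin \o u) by exact: integrableS iu.
have ivA : P.-integrable A (EFin \o v) by exact: integrableS iv.
have muv : measurable_fun A (fun x => ((u x)%:E - (v x)%:E)%E).
  by have := measurable_int _ (integrableB mA iuA ivA).
have : (\int[P]_(x in A) `|(u x)%:E - (v x)%:E| = 0)%E.
  have -> : (\int[P]_(x in A) `|(u x)%:E - (v x)%:E| =
             \int[P]_(x in A) ((u x)%:E - (v x)%:E))%E.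
    apply: eq_integral => x /set_mem vu.
    by rewrite gee0_abs// sube_ge0// lee_fin ltW.
  apply/eqP; rewrite eq_le; apply/andP; split; last first.
    by apply: integral_ge0 => x vu; rewrite sube_ge0// lee_fin ltW.
  rewrite (integralB mA iuA ivA) sube_le0; first exact: uv.
move=> /(ae_eq_integral_abs P mA muv).
apply: filterS => x /=.
have [//|vu] := leP (u x) (v x).
by move=> /(_ vu) [] /eqP; rewrite subr_eq0 => /eqP uvx; move: vu; rewrite uvx ltxx.
Qed.

End sub_sigma_algebra.

(** * Products with measurable factors and integrability *)

Section integral_tools.
Context {d : measure_display} {T : measurableType d} {R : realType}.
Variable P : probability T R.
Import HBNNSimple.

Lemma integral_set_indicM (A : set T) (f : T -> R) :
  (\int[P]_(x in A) (f x)%:E = \int[P]_x (f x * \1_A x)%:E)%E.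
Proof.
rewrite integral_mkcond; apply: eq_integral => x _.
by rewrite /patch indicE; case: ifP => _; rewrite ?mulr1 ?mulr0.
Qed.

Lemma ae_bounded_integrable (f : T -> R) (c : R) :
  measurable_fun setT f -> {ae P, forall x, `|f x| <= c} ->
  P.-integrable setT (EFin \o f).
Proof.
move=> mf fc; apply/integrableP; split; first exact/measurable_EFinP.
apply: (@le_lt_trans _ _ (\int[P]_x (`|c|)%:E)%E); last first.
  by rewrite integral_cst//= probability_setT mule1 ltry.
apply: ae_ge0_le_integral => //.
- by apply: measurableT_comp => //; exact/measurable_EFinP.
- apply: filterS fc => x fcx _ /=; rewrite lee_fin.
  exact: le_trans (ler_norm _).
Qed.

(** The pull-out property of conditional expectations. [Y] is approximated from below by simple
    functions built on the sigma-algebra [G], so that their level sets lie in [G] and the hypothesis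
    applies to each; monotone convergence does the rest. *)
Lemma integral_mul_sub (G : set (set T)) (X X' Y : T -> R) :
  sigma_algebra setT G -> G `<=` measurable ->
  measurable_fun setT X -> measurable_fun setT X' -> Gmeasurable G Y ->
  (forall x, 0 <= X x) -> (forall x, 0 <= X' x) -> (forall x, 0 <= Y x) ->
  (forall A, G A -> (\int[P]_(x in A) (X x)%:E = \int[P]_(x in A) (X' x)%:E)%E) ->
  (\int[P]_x (X x * Y x)%:E = \int[P]_x (X' x * Y x)%:E)%E.
Proof.
move=> sG Gm mX mX' GY X0 X'0 Y0 XX'.
have mY : measurable_fun [set: g_sigma_algebraType G] (EFin \o Y).
  by apply/measurable_EFinP; exact/GmeasurableP.
pose h := nnsfun_approx measurableT mY.
have hG n (y : R) : G (h n @^-1` [set y]).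
  by apply/sub_measurableE => //; exact: measurable_funPTI.
have mh n : measurable_fun [set: T] (h n).
  apply: (@Gmeasurable_fun _ _ _ G) => //; apply/(GmeasurableP sG).
  exact: measurable_funP.
have h0 n x : 0 <= h n x by exact: fun_ge0.
have cvgh (Z : T -> R) : measurable_fun setT Z -> (forall x, 0 <= Z x) ->
    (\int[P]_x (Z x * h n x)%:E @[n --> \oo] --> \int[P]_x (Z x * Y x)%:E)%E.
  move=> mZ Z0.
  have cZ x : ((Z x * h n x)%:E @[n --> \oo] --> (Z x * Y x)%:E)%E.
    have : (EFin \o h ^~ x @ \oo --> (EFin \o Y) x)%E.
      by apply: cvg_nnsfun_approx => // y _; rewrite lee_fin.
    by move=> hY; exact: (cvgeZl (isT : (Z x)%:E \is a fin_num) hY).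
  have := @cvg_monotone_convergence _ _ _ P setT measurableT
    (fun n x => (Z x * h n x)%:E) _ _ _.
  under [X in _ -> _ -> _ -> _ --> X]eq_integral do rewrite (cvg_lim _ (cZ _))//.
  apply.
  - by move=> n; apply/measurable_EFinP; exact: measurable_funM.
  - by move=> n x _; rewrite lee_fin mulr_ge0.
  - move=> x _ m n mn; rewrite lee_fin ler_wpM2l//.
    by have /lefP/(_ x) := nd_nnsfun_approx measurableT mY mn.
suff XX'h n : (\int[P]_x (X x * h n x)%:E = \int[P]_x (X' x * h n x)%:E)%E.
  rewrite -(cvg_lim _ (cvgh _ mX X0))// -(cvg_lim _ (cvgh _ mX' X'0))//.
  by congr (limn _); exact/funext.
  pose t : seq R := fset_set (range (h n)).
  have intZ (Z : T -> R) : measurable_fun setT Z -> (forall x, 0 <= Z x) ->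
      (\int[P]_x (Z x * h n x)%:E =
       \sum_(i < size t) (t`_i)%:E *
         \int[P]_(x in h n @^-1` [set t`_i]) (Z x)%:E)%E.
    move=> mZ Z0.
    have t0 (i : 'I_(size t)) : 0 <= t`_i.
      have : t`_i \in fset_set (range (h n)) by exact: mem_nth.
      by rewrite in_fset_set// => /set_mem[x _ <-].
    have mi (i : 'I_(size t)) : measurable_fun setT
        (fun x => Z x * \1_(h n @^-1` [set t`_i]) x).
      apply: measurable_funM => //; apply: measurable_indic.
      by apply: Gm; exact: hG.
    transitivity (\int[P]_x (\sum_(i < size t)
        ((t`_i)%:E * (Z x * \1_(h n @^-1` [set t`_i]) x)%:E)))%E.
      apply: eq_integral => x _.
      rewrite [in LHS](fimfunEord (h n) x) mulr_sumr sumEFin; congr EFin.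
      by apply: eq_bigr => i _; ring.
    rewrite ge0_integral_sum//; last 2 first.
    - by move=> i; apply: measurable_funeM; exact/measurable_EFinP.
    - by move=> i x _; rewrite -EFinM lee_fin mulr_ge0 ?mulr_ge0.
    apply: eq_bigr => i _; rewrite ge0_integralZl_EFin//.
    - by rewrite -integral_set_indicM.
    - by move=> x _; rewrite lee_fin mulr_ge0.
    - exact/measurable_EFinP.
  by rewrite !intZ//; apply: eq_bigr => i _; rewrite XX'.
Qed.

Lemma integrable_EFinD (f g : T -> R) :
  P.-integrable setT (EFin \o f) -> P.-integrable setT (EFin \o g) ->
  P.-integrable setT (EFin \o (fun x => f x + g x)).
Proof. by move=> iF ig; exact: (integrableD measurableT iF ig). Qed.

Lemma integrable_EFinB (f g : T -> R) :
  P.-integrable setT (EFin \o f) -> P.-integrable setT (EFin \o g) ->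
  P.-integrable setT (EFin \o (fun x => f x - g x)).
Proof. by move=> iF ig; exact: (integrableB measurableT iF ig). Qed.

Lemma integrable_EFinZ (c : R) (f : T -> R) :
  P.-integrable setT (EFin \o f) ->
  P.-integrable setT (EFin \o (fun x => c * f x)).
Proof. by move=> iF; exact: (integrableZl measurableT c iF). Qed.

Lemma integrable_EFinM_indic (f : T -> R) (A : set T) : measurable A ->
  P.-integrable setT (EFin \o f) ->
  P.-integrable setT (EFin \o (fun x => f x * \1_A x)).
Proof.
move=> mA iF; have mf : measurable_fun setT f.
  by apply/measurable_EFinP; exact: measurable_int iF.
apply: (le_integrable measurableT _ _ iF).
  by apply/measurable_EFinP; apply: measurable_funM => //; exact: measurable_indic.
move=> x _ /=; rewrite lee_fin normrM ler_piMr// indicE.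
by case: (_ \in _); rewrite ?normr1 ?normr0.
Qed.

Lemma integral_EFinB (X Y : T -> R) (A : set T) : measurable A ->
  P.-integrable setT (EFin \o X) -> P.-integrable setT (EFin \o Y) ->
  (\int[P]_(x in A) (X x - Y x)%:E =
   \int[P]_(x in A) (X x)%:E - \int[P]_(x in A) (Y x)%:E)%E.
Proof.
move=> mA iX iY.
by rewrite -integralB_EFin//; [exact: integrableS iX|exact: integrableS iY].
Qed.

Lemma ae_bounded_mul_integrable (f g : T -> R) (a b : R) :
  measurable_fun setT f -> measurable_fun setT g ->
  {ae P, forall x, `|f x| <= a} -> {ae P, forall x, `|g x| <= b} ->
  P.-integrable setT (EFin \o (f \* g)).
Proof.
move=> mf mg fa gb; apply: (@ae_bounded_integrable _ (a * b)).
  exact: measurable_funM.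
by apply: filterS2 fa gb => x fa gb /=; rewrite normrM ler_pM.
Qed.

(* Shifting by the bound reduces the claim to nonnegative functions. *)
Lemma Rintegral_mul_sub_bounded (G : set (set T)) (X X' Y : T -> R) (c : R) :
  sigma_algebra setT G -> G `<=` measurable ->
  measurable_fun setT X -> measurable_fun setT X' -> Gmeasurable G Y ->
  {ae P, forall x, `|X x| <= c} -> {ae P, forall x, `|X' x| <= c} ->
  {ae P, forall x, `|Y x| <= c} ->
  (forall A, G A -> (\int[P]_(x in A) (X x)%:E = \int[P]_(x in A) (X' x)%:E)%E) ->
  \int[P]_x (X x * Y x) = \int[P]_x (X' x * Y x).
Proof.
move=> sG Gm mX mX' GY Xc X'c Yc XX'.
have mY : measurable_fun setT Y by exact: (Gmeasurable_fun Gm GY).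
(* The maximum with 0 changes [Z + c] only on a null set, and makes it nonnegative everywhere. *)
pose sh (Z : T -> R) x := Num.max (Z x + c) 0.
have mc (Z : T -> R) : measurable_fun setT Z -> measurable_fun setT (fun x => Z x + c).
  by move=> mZ; apply: measurable_funD.
have msh (Z : T -> R) : measurable_fun setT Z -> measurable_fun setT (sh Z).
  by move=> mZ; apply: measurable_maxr => //; exact: mc.
have shE (Z : T -> R) : {ae P, forall x, `|Z x| <= c} ->
    {ae P, forall x, sh Z x = Z x + c}.
  apply: filterS => x; rewrite ler_norml => /andP[Zc _]; rewrite /sh.
  by apply/max_idPl; rewrite -lerBlDr sub0r.
have iX (Z : T -> R) := @ae_bounded_integrable Z c.
have ic : P.-integrable setT (EFin \o cst c) by exact: finite_measure_integrable_cst.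
have sh0 Z x : 0 <= sh Z x by rewrite le_max lexx orbT.
have GshY : Gmeasurable G (sh Y).
  move/(GmeasurableP sG) : GY => mGY; apply/(GmeasurableP sG).
  by apply: measurable_maxr => //; apply: measurable_funD.
have intsh (Z : T -> R) A : measurable_fun setT Z ->
    {ae P, forall x, `|Z x| <= c} -> G A ->
    (\int[P]_(x in A) (sh Z x)%:E =
     \int[P]_(x in A) (Z x)%:E + \int[P]_(x in A) c%:E)%E.
  move=> mZ Zc GA; rewrite -integralD_EFin//; first last.
  - by apply: integrableS ic => //; exact: Gm.
  - by apply: integrableS (iX _ mZ Zc) => //; exact: Gm.
  - exact: Gm.
  apply: ae_eq_integral; first exact: Gm.
  - by apply/measurable_EFinP; apply: measurable_funTS; exact: msh.
  - by apply/measurable_EFinP; apply: measurable_funTS; exact: mc.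
  - by apply: filterS (shE _ Zc) => x -> .
have := @integral_mul_sub G (sh X) (sh X') (sh Y) sG Gm (msh _ mX) (msh _ mX')
  GshY (sh0 _) (sh0 _) (sh0 _).
have XX'sh A : G A ->
    (\int[P]_(x in A) (sh X x)%:E = \int[P]_(x in A) (sh X' x)%:E)%E.
  by move=> GA; rewrite !intsh// XX'.
move=> /(_ XX'sh) prodE.
(* Expansion of (Z + c)(Y + c). Apart from the wanted product, only the integral of [Z] depends on
   [Z], and it is the same for [X] and [X']. *)
have ZY (Z : T -> R) : measurable_fun setT Z -> {ae P, forall x, `|Z x| <= c} ->
    (\int[P]_x (sh Z x * sh Y x)%:E =
     (\int[P]_x (Z x * Y x) + c * \int[P]_x (Z x) + c * \int[P]_x (Y x + c))%:E)%E.
  move=> mZ Zc.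
  have iZY := ae_bounded_mul_integrable mZ mY Zc Yc.
  have iZ := iX _ mZ Zc.
  have iYc : P.-integrable setT (EFin \o (fun x => Y x + c)).
    by apply: integrable_EFinD => //; exact: iX.
  rewrite -!RintegralZl//.
  rewrite -RintegralD//; last exact: integrable_EFinZ.
  rewrite -RintegralD//; [|by apply: integrable_EFinD => //; exact: integrable_EFinZ|exact: integrable_EFinZ].
  have iall : P.-integrable setT
      (EFin \o (fun x => Z x * Y x + c * Z x + c * (Y x + c))).
    by apply: integrable_EFinD; [apply: integrable_EFinD => //; exact: integrable_EFinZ|exact: integrable_EFinZ].
  rewrite /Rintegral fineK; last exact: integrable_fin_num.
  apply: ae_eq_integral => //.
  - by apply/measurable_EFinP; apply: measurable_funM; exact: msh.
  - exact: measurable_int iall.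
  - apply: filterS2 (shE _ Zc) (shE _ Yc) => x -> -> _; congr EFin; ring.
have := prodE; rewrite !ZY// => -[] /addIr.
suff -> : \int[P]_x X x = \int[P]_x X' x by move=> /addIr.
by rewrite /Rintegral XX'//; exact: sub_setT.
Qed.

End integral_tools.

(** * Conditional expectations and martingales *)

Section conditional_expectation.
Context {d : measure_display} {T : measurableType d} {R : realType}.
Variables (P : probability T R) (F : nat -> set (set T)).
Variable E : nat -> (T -> R) -> T -> R.
Hypotheses (hF : is_filtration F) (hE : is_condexp_op P F E).

Lemma filtration_sigma n : sigma_algebra setT (F n).
Proof. by case: hF. Qed.

Lemma filtration_measurable n : F n `<=` measurable.
Proof. by case: hF => _ []. Qed.

Lemma filtration_le m n : (m <= n)%N -> F m `<=` F n.
Proof.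
move=> mn; rewrite -(subnK mn); elim: (n - m)%N => [//|k IH] A /IH.
by case: hF => _ [_]; apply.
Qed.

Let sF := filtration_sigma.
Let mF := filtration_measurable.

Lemma filtration_measurable_fun n (f : T -> R) : Gmeasurable (F n) f -> measurable_fun setT f.
Proof. by move=> Gf; apply: (@Gmeasurable_fun _ _ _ (F n)) => //; exact: mF. Qed.

Lemma Gmeasurable_filtration_le m n (f : T -> R) : (m <= n)%N ->
  Gmeasurable (F m) f -> Gmeasurable (F n) f.
Proof. by move=> mn Gf B mB; apply: (filtration_le mn); exact: Gf. Qed.

(** [E n f] and [v] have equal integrals over all sets of [F n], so each dominates the other a.e.
    Every identity for [E] below is obtained in this way. *)
Lemma condexp_unique n (f v : T -> R) :
  P.-integrable setT (EFin \o f) -> Gmeasurable (F n) v ->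
  P.-integrable setT (EFin \o v) ->
  (forall A, F n A -> (\int[P]_(x in A) (v x)%:E = \int[P]_(x in A) (f x)%:E)%E) ->
  {ae P, forall x, E n f x = v x}.
Proof.
move=> iF Gv iv vf; have [GE iE EE] := hE n iF.
have EvE A : F n A -> (\int[P]_(x in A) (E n f x)%:E = \int[P]_(x in A) (v x)%:E)%E.
  by move=> FA; rewrite EE// vf.
have le1 : {ae P, forall x, E n f x <= v x}.
  by apply: (@ae_le_sub _ _ _ P _ (sF n) (@mF n)) => // A FA; rewrite EvE.
have le2 : {ae P, forall x, v x <= E n f x}.
  by apply: (@ae_le_sub _ _ _ P _ (sF n) (@mF n)) => // A FA; rewrite EvE.
by apply: filterS2 le1 le2 => x ? ?; apply/eqP; rewrite eq_le; apply/andP.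
Qed.

Lemma condexp_ge0 n (f : T -> R) :
  P.-integrable setT (EFin \o f) -> (forall x, 0 <= f x) ->
  {ae P, forall x, 0 <= E n f x}.
Proof.
move=> iF f0; have [GE iE EE] := hE n iF.
apply: (@ae_le_sub _ _ _ P _ (sF n) (@mF n) (cst 0)) => //.
- exact: Gmeasurable_cst.
- exact: finite_measure_integrable_cst.
- move=> A FA; rewrite EE// integral0_eq//; apply: integral_ge0 => x _.
  by rewrite lee_fin.
Qed.

Lemma condexpZ n (c : R) (f : T -> R) : P.-integrable setT (EFin \o f) ->
  {ae P, forall x, E n (fun y => c * f y) x = c * E n f x}.
Proof.
move=> iF; have [GE iE EE] := hE n iF.
apply: condexp_unique.
- exact: integrable_EFinZ.
- by apply: GmeasurableM => //; exact: Gmeasurable_cst.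
- exact: integrable_EFinZ.
- move=> A FA; have mA := mF FA.
  under eq_integral do rewrite EFinM.
  under [RHS]eq_integral do rewrite EFinM.
  by rewrite !integralZl//; [rewrite EE|exact: integrableS iF|exact: integrableS iE].
Qed.

(** The martingale property in integral form, free of the chosen versions [E]; differences and
    stopping are easier to treat in this form. *)
Definition mart (g : nat -> T -> R) :=
  (forall n, Gmeasurable (F n) (g n) /\ P.-integrable setT (EFin \o g n)) /\
  (forall n A, F n A ->
    (\int[P]_(x in A) (g n.+1 x)%:E = \int[P]_(x in A) (g n x)%:E)%E).

Lemma martingale_mart f : martingale P F E f -> mart f.
Proof.
move=> [fm Ef]; split=> // n A FA; have mA := mF FA.
have [Gf iF] := fm n; have [Gf1 if1] := fm n.+1.
have [GE iE EE] := hE n if1.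
rewrite -EE//; apply: ae_eq_integral => //.
- exact: measurable_funTS (measurable_int _ iE).
- exact: measurable_funTS (measurable_int _ iF).
- by apply: filterS (Ef n) => x /= -> .
Qed.

Lemma mart_integral g m n A : mart g -> (m <= n)%N -> F m A ->
  (\int[P]_(x in A) (g n x)%:E = \int[P]_(x in A) (g m x)%:E)%E.
Proof.
move=> [_ gE] mn FA; rewrite -(subnK mn); elim: (n - m)%N => [//|k IH].
by rewrite addSn gE//; apply: filtration_le FA; exact: leq_addl.
Qed.

Lemma martB g h : mart g -> mart h -> mart (fun n x => g n x - h n x).
Proof.
move=> [gm gE] [hm hhE]; split=> [n|n A FA].
  have [Gg ig] := gm n; have [Gh ih] := hm n.
  by split; [exact: GmeasurableB|exact: integrable_EFinB].
have mA := mF FA.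
have [Gg ig] := gm n; have [Gh ih] := hm n.
have [Gg1 ig1] := gm n.+1; have [Gh1 ih1] := hm n.+1.
by rewrite !integral_EFinB// gE// hhE.
Qed.

Lemma martingale_condexp f : P.-integrable setT (EFin \o f) ->
  martingale P F E (fun n => E n f).
Proof.
move=> iF; split=> n.
  by have [GE iE _] := hE n iF.
have [GE iE EE] := hE n iF; have [GE1 iE1 EE1] := hE n.+1 iF.
apply: condexp_unique => // A FA.
by rewrite EE// EE1//; exact: filtration_le FA.
Qed.

(** The stopped process, with [None] meaning that the path is never stopped. *)
Definition stopped (nu : T -> option nat) (f : nat -> T -> R) n x :=
  f (if nu x is Some k then minn n k else n) x.

Lemma stopping_time_gt nu n : stopping_time F nu -> F n [set x | nu_ge nu n.+1 x].
Proof.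
move=> /(_ n) Fn.
rewrite (_ : [set x | _] = ~` [set x | exists2 k, (k <= n)%N & nu x = Some k]).
  exact: sub_setC.
apply/seteqP; split=> x /=; rewrite /nu_ge.
  by move=> + [k kn nuk]; rewrite nuk ltnNge kn.
case: (nu x) => [k|//] nk; rewrite ltnNge; apply/negP => kn.
by apply: nk; exists k.
Qed.

Lemma stoppedS nu f n x : stopped nu f n.+1 x =
  stopped nu f n x + (f n.+1 x - f n x) * \1_[set x | nu_ge nu n.+1 x] x.
Proof.
have -> : \1_[set x | nu_ge nu n.+1 x] x = (nu_ge nu n.+1 x)%:R :> R.
  by rewrite indicE; congr (nat_of_bool _)%:R; apply/idP/idP => [/set_mem|/mem_set].
rewrite /stopped /nu_ge; case: (nu x) => [k|]; last by rewrite mulr1 addrC subrK.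
have [nk|kn] := ltnP n k.
  by rewrite (minn_idPl nk) mulr1 addrC subrK.
by rewrite (minn_idPr (leqW kn)) mulr0 addr0.
Qed.

(** Stopping multiplies the increment from [n] to [n.+1] by the indicator of an event of [F n], so
    its integral over any set of [F n] still vanishes. *)
Lemma mart_stopped nu f : stopping_time F nu -> mart f -> mart (stopped nu f).
Proof.
move=> st [fm fE].
pose A n := [set x | nu_ge nu n.+1 x].
have FA n : F n (A n) by exact: stopping_time_gt.
have sE n : stopped nu f n.+1 =
    (fun x => stopped nu f n x + (f n.+1 x - f n x) * \1_(A n) x).
  by apply/funext => x; rewrite stoppedS.
have id n : P.-integrable setT (EFin \o (fun x => (f n.+1 x - f n x) * \1_(A n) x)).
  have [_ i1] := fm n; have [_ i2] := fm n.+1.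
  apply: integrable_EFinM_indic; [exact: mF (FA n)|exact: integrable_EFinB].
have sm n : Gmeasurable (F n) (stopped nu f n) /\
            P.-integrable setT (EFin \o stopped nu f n).
  elim: n => [|n [Gs is_]].
    have -> : stopped nu f 0 = f 0%N.
      by apply/funext => x; rewrite /stopped; case: (nu x) => [k|//]; rewrite min0n.
    exact: fm.
  rewrite sE; split; last exact: integrable_EFinD.
  have [G1 _] := fm n; have [G2 _] := fm n.+1.
  apply: GmeasurableD => //; first exact: Gmeasurable_filtration_le Gs.
  apply: GmeasurableM => //; first apply: GmeasurableB => //.
  - exact: Gmeasurable_filtration_le G1.
  - by apply: Gmeasurable_indic => //; apply: (filtration_le (leqnSn n)).
split=> // n B FB; have mB := mF FB; have [_ isn] := sm n.
rewrite sE.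
rewrite integralD_EFin//; [|exact: integrableS isn|exact: integrableS (id n)].
rewrite [X in (_ + X)%E](_ : _ = 0)%E ?adde0//.
have [_ i1] := fm n; have [_ i2] := fm n.+1.
transitivity (\int[P]_(x in B `&` A n) (f n.+1 x - f n x)%:E)%E.
  rewrite integral_mkcondr; apply: eq_integral => x _.
  by rewrite /patch /= indicE; case: ifP => _; rewrite ?mulr1 ?mulr0.
have FBA : F n (B `&` A n) by exact: sub_setI.
rewrite integral_EFinB//; last exact: mF FBA.
rewrite fE// subee//; apply: integrable_fin_num.
  exact: mF FBA.
by apply: integrableS i1 => //; exact: mF FBA.
Qed.

(** Orthogonality of increments: the pull-out property gives E[g_n g_m] = E[g_m^2]. The bounds [c]
    make all products integrable. *)
Lemma mart_increment_sqr g (c : nat -> R) m n : mart g ->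
  (forall n, {ae P, forall x, `|g n x| <= c n}) -> (m <= n)%N ->
  \int[P]_x (g n x - g m x) ^+ 2 = \int[P]_x (g n x ^+ 2) - \int[P]_x (g m x ^+ 2).
Proof.
move=> mg gc mn; have [gm gE] := mg.
have mgn k : measurable_fun setT (g k) by exact: filtration_measurable_fun (gm k).1.
pose C := Num.max (c m) (c n).
have gC k : (k == m) || (k == n) -> {ae P, forall x, `|g k x| <= C}.
  move=> km; apply: filterS (gc k) => x /le_trans; apply.
  by rewrite le_max; case/orP: km => /eqP ->; rewrite lexx ?orbT.
have gCm := gC m; have gCn := gC n.
rewrite eqxx in gCm; rewrite eqxx orbT in gCn.
have {}gCm := gCm isT; have {}gCn := gCn isT.
have prodE : \int[P]_x (g n x * g m x) = \int[P]_x (g m x * g m x).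
  apply: (@Rintegral_mul_sub_bounded _ _ _ P (F m) _ _ _ C) => //.
  - exact: (gm m).1.
  - by move=> A FA; exact: mart_integral.
have i1 := ae_bounded_mul_integrable (mgn n) (mgn n) gCn gCn.
have i2 := ae_bounded_mul_integrable (mgn n) (mgn m) gCn gCm.
have i3 := ae_bounded_mul_integrable (mgn m) (mgn m) gCm gCm.
under eq_Rintegral do rewrite expr2.
transitivity (\int[P]_x (g n x * g n x - 2 * (g n x * g m x) + g m x * g m x)).
  by apply: eq_Rintegral => x _; ring.
rewrite RintegralD//; last by apply: integrable_EFinB => //; exact: integrable_EFinZ.
rewrite RintegralB//; last exact: integrable_EFinZ.
rewrite RintegralZl// prodE.
under [X in _ = X - _]eq_Rintegral do rewrite expr2.
under [X in _ = _ - X]eq_Rintegral do rewrite expr2.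
ring.
Qed.

(* Along a fast subsequence the L2-Cauchy property makes the increments absolutely summable in L1,
   so the subsequence converges dominatedly to a closing variable. *)
Lemma mart_closed g (c : nat -> R) (C : R) : mart g ->
  (forall n, {ae P, forall x, `|g n x| <= c n}) ->
  (forall n, \int[P]_x (g n x ^+ 2) <= C) ->
  exists b : T -> R, [/\ measurable_fun setT b, P.-integrable setT (EFin \o b) &
    forall n, {ae P, forall x, E n b x = g n x}].
Proof.
move=> mg gc gC; have [gm gE] := mg.
have mgn k : measurable_fun setT (g k) by exact: filtration_measurable_fun (gm k).1.
pose e n := \int[P]_x (g n x ^+ 2).
have e_nd : nondecreasing_seq e.
  move=> m n mn; rewrite -subr_ge0 -(mart_increment_sqr mg gc mn).
  by apply: Rintegral_ge0 => x _; exact: sqr_ge0.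
have e_cvg : cvgn e.
  apply: nondecreasing_is_cvgn => //; exists C => _ [n _ <-]; exact: gC.
(* The second moments increase and are bounded, hence Cauchy; after time [N k] an increment has L2
   norm at most 2^-k. *)
have /choice[N NE] : forall k : nat, exists N, forall m n : nat, (N <= m)%N -> (m <= n)%N ->
    e n - e m <= (2^-1 ^+ k) ^+ 2.
  move=> k.
  have a0 : (0 : R) < (2^-1 ^+ k) ^+ 2 by rewrite !exprn_gt0.
  have /cvgrPdist_lt/(_ _ a0)[N _ NE] := e_cvg.
  exists N => m n Nm mn; apply/ltW/(le_lt_trans _ (NE _ Nm)).
  apply: le_trans (ler_norm _); rewrite lerB//.
  exact: nondecreasing_cvgn_le.
(* Summing the [N j] makes [s] nondecreasing and at least [N]; the successors also give
   [k <= s k]. *)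
pose s k := (\sum_(j < k.+1) (N j).+1)%N.
have sS k : (s k <= s k.+1)%N by rewrite /s [leqRHS]big_ord_recr /= leq_addr.
have sN k : (N k <= s k)%N.
  by rewrite /s big_ord_recr /=; apply: leq_trans (leq_addl _ _).
have sk k : (k <= s k)%N.
  elim: k => // k IH; rewrite /s big_ord_recr /=.
  by rewrite addnS ltnS; apply: (leq_trans IH); exact: leq_addr.
pose D k x : R := `|g (s k.+1) x - g (s k) x|.
have mD k : measurable_fun setT (EFin \o D k).
  by apply/measurable_EFinP; apply: measurableT_comp => //; exact: measurable_funB.
have intD k : (\int[P]_x (D k x)%:E <= (2^-1 ^+ k)%:E)%E.
  set a : R := 2^-1 ^+ k.
  have a0 : 0 < a by rewrite exprn_gt0.
  pose z x := g (s k.+1) x - g (s k) x.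
  have zb : {ae P, forall x, `|z x| <= c (s k.+1) + c (s k)}.
    apply: filterS2 (gc (s k.+1)) (gc (s k)) => x h1 h2.
    by apply: le_trans (ler_normB _ _) _; exact: lerD.
  have mz : measurable_fun setT z by exact: measurable_funB.
  have iz := ae_bounded_mul_integrable mz mz zb zb.
  have ia : P.-integrable setT (EFin \o cst (a / 2)) by exact: finite_measure_integrable_cst.
  have iz2 := integrable_EFinZ (2 * a)^-1 iz.
  have iall := integrable_EFinD ia iz2.
  (* The pointwise bound |z| <= a/2 + z^2/(2a) replaces the Cauchy-Schwarz inequality: an L2 norm at
     most [a] gives an L1 norm at most [a]. *)
  apply: (@le_trans _ _ (\int[P]_x (a / 2 + (2 * a)^-1 * (z x * z x))%:E)%E).
    apply: ge0_le_integral => //.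
    - by move=> x _; rewrite lee_fin /D.
    - exact: mD.
    - exact: measurable_int iall.
    - move=> x _; rewrite lee_fin.
      have -> : D k x = `|z x| by [].
      have -> : z x * z x = `|z x| ^+ 2 by rewrite real_normK ?num_real// expr2.
      have -> : a / 2 + (2 * a)^-1 * `|z x| ^+ 2 = `|z x| + (2 * a)^-1 * (`|z x| - a) ^+ 2.
        by field; rewrite gt_eqF.
      by rewrite lerDl mulr_ge0 ?sqr_ge0// invr_ge0 mulr_ge0// ltW.
  have -> : (\int[P]_x (a / 2 + (2 * a)^-1 * (z x * z x))%:E =
             (a / 2 + (2 * a)^-1 * \int[P]_x (z x ^+ 2))%:E)%E.
    under eq_Rintegral do rewrite expr2.
    rewrite -RintegralZl//.
    have cE : \int[P]_(x in setT) cst (a / 2) x = a / 2.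
      transitivity (fine ((a / 2)%:E * P setT)%E); last by rewrite probability_setT mule1.
      by rewrite /Rintegral (integral_cst P measurableT (a / 2)%:E).
    rewrite -[X in (X + _)%:E]cE -RintegralD// /Rintegral fineK//.
    exact: integrable_fin_num.
  rewrite lee_fin /z (mart_increment_sqr mg gc (sS k)).
  have := NE k _ _ (sN k) (sS k); rewrite -/a -/(e _) -/(e _) => h.
  rewrite [leRHS](_ : a = a / 2 + (2 * a)^-1 * a ^+ 2); last by field; rewrite gt_eqF.
  by rewrite lerD2l ler_wpM2l// invr_ge0 mulr_ge0// ltW.
have D0 k x : (0 <= (D k x)%:E)%E by rewrite lee_fin /D normr_ge0.
pose W x : \bar R := (\sum_(k <oo) (D k x)%:E)%E.
have mW : measurable_fun setT W.
  by apply: ge0_emeasurable_sum => [k x _ _|k _]; [exact: D0|exact: mD].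
have W0 x : (0 <= W x)%E by apply: nneseries_ge0 => k _ _; exact: D0.
have intW : (\int[P]_x W x < +oo)%E.
  rewrite integral_nneseries//.
  apply: (@le_lt_trans _ _ 2%:E); last by rewrite ltry.
  apply: lime_le; first by apply: is_cvg_nneseries => k _ _; apply: integral_ge0 => x _; exact: D0.
  apply: nearW => n.
  apply: (@le_trans _ _ (\sum_(0 <= k < n) (2^-1 ^+ k)%:E)%E); first exact: lee_sum.
  rewrite sumEFin lee_fin big_mkord.
  suff -> : \sum_(k < n) (2^-1 : R) ^+ k = 2 - 2 * 2^-1 ^+ n.
    by rewrite gerBl mulr_ge0// exprn_ge0.
  elim: n => [|n IH]; first by rewrite big_ord0 expr0 mulr1 subrr.
  by rewrite big_ord_recr /= IH exprS; field.
pose G x : \bar R := ((`|g (s 0) x|)%:E + W x)%E.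
have iW : P.-integrable setT W.
  apply/integrableP; split => //.
  by under eq_integral do rewrite gee0_abs//.
have iG : P.-integrable setT G.
  apply: integrableD => //.
  exact: integrable_norm (gm _).2.
have gG k x : (`|(g (s k) x)%:E| <= G x)%E.
  apply: (@le_trans _ _ (`|g (s 0) x| + \sum_(0 <= j < k) D j x)%:E).
    rewrite lee_fin; elim: k => [|k IH]; first by rewrite big_geq// addr0.
    rewrite big_nat_recr//= addrA.
    have -> : g (s k.+1) x = g (s k) x + (g (s k.+1) x - g (s k) x) by rewrite addrC subrK.
    by apply: le_trans (ler_normD _ _) _; exact: lerD.
  rewrite EFinD -sumEFin leeD2l//.
  exact: nneseries_lim_ge.
have cvgg : {ae P, forall x, cvgn (fun k => g (s k) x)}.
  have := integrable_ae measurableT iW.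
  apply: filterS => x /(_ I) Wfin.
  have cD : cvgn (series (fun j => D j x)).
    apply: nondecreasing_is_cvgn.
      by apply: nondecreasing_series => j _ _; exact: normr_ge0.
    exists (fine (W x)) => _ [k _ <-].
    by rewrite -lee_fin fineK// /series /= -sumEFin; exact: nneseries_lim_ge.
  have cg : cvgn (series (fun j => g (s j.+1) x - g (s j) x)) by exact: normed_cvg.
  have -> : (fun k => g (s k) x) =
      (fun k => series (fun j => g (s j.+1) x - g (s j) x) k + g (s 0) x).
    by apply/funext => k; rewrite /series /= telescope_sumr// subrK.
  by apply: is_cvgD => //; exact: is_cvg_cst.
(* The upper limit is measurable everywhere and equals the limit wherever the subsequence
   converges. *)
pose b x := fine (limn_esup (fun k => (g (s k) x)%:E)).
have mb : measurable_fun setT b.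
  apply: measurableT_comp => //.
  by apply: measurable_fun_limn_esup => k; exact/measurable_EFinP.
have gb : {ae P, forall x, (g (s k) x)%:E @[k --> \oo] --> (b x)%:E}.
  apply: filterS cvgg => x cg.
  have cE : (g (s k) x)%:E @[k --> \oo] --> (limn (fun k => g (s k) x))%:E.
    by apply: cvg_EFin; [exact: nearW|exact: cg].
  suff -> : b x = limn (fun k => g (s k) x) by [].
  rewrite /b (_ : limn_esup _ = (limn (fun k => g (s k) x))%:E)//.
  by rewrite is_cvg_limn_esupE ?(cvg_lim _ cE)//; apply/cvg_ex; eexists; exact: cE.
have intAb A : measurable A ->
    P.-integrable A (EFin \o b) /\
    (\int[P]_(x in A) (g (s k) x)%:E @[k --> \oo] --> \int[P]_(x in A) (b x)%:E)%E.
  move=> mA.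
  have [] := @dominated_convergence _ _ _ P A mA (fun k x => (g (s k) x)%:E) (EFin \o b) G.
  - by move=> k; apply: measurable_funTS; exact/measurable_EFinP.
  - by apply: measurable_funTS; exact/measurable_EFinP.
  - by apply: filterS gb => x gbx _.
  - exact: integrableS iG.
  - by apply: aeW => x k _; exact: gG.
  - by move=> ? _ ?; split.
have [ib _] := intAb setT measurableT.
exists b; split => // n.
apply: condexp_unique => //; [exact: (gm n).1|exact: (gm n).2|].
move=> A FA; have [_ bE] := intAb A (mF FA).
rewrite -(cvg_lim _ bE)//; apply/esym/cvg_lim => //.
(* Once [s k >= n], the integral over [A] no longer depends on [k]. *)
apply: cvg_near_cst; exists n => // k /= nk.
by apply: mart_integral => //; exact: leq_trans (sk k).
Qed.

End conditional_expectation.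

(** * The maximal and square functions as suprema of seminorms *)

Section gauges.
Context {d : measure_display} {T : measurableType d} {R : realType}.
Variables (P : probability T R) (F : nat -> set (set T)).

(* Both maximal operators are suprema [Top f = sup_n gam n f] of seminorms depending on the
   first [n] terms of the sequence only; this record lists what the two proofs share. *)
Record gauge (Top : (nat -> T -> R) -> T -> \bar R)
    (gam : nat -> (nat -> R) -> R) : Prop := Gauge {
  gauge_ge0 : forall n u, 0 <= gam n u;
  gaugeD : forall n u v, gam n (fun i => u i + v i) <= gam n u + gam n v;
  gaugeZ : forall n c u, gam n (fun i => c * u i) = `|c| * gam n u;
  gauge_cvg : forall n (u : nat -> nat -> R) v,
    (forall i, u N i @[N --> \oo] --> v i) ->
    gam n (u N) @[N --> \oo] --> gam n v;
  gauge_measurable : forall n (f : nat -> T -> R),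
    (forall i, Gmeasurable (F i) (f i)) -> Gmeasurable (F n) (fun x => gam n (f ^~ x));
  gauge_norm_le : forall n u, u 0%N = 0 -> `|u n| <= n.+1%:R * gam n u;
  gauge_stop : forall n m u, gam n (fun i => u (minn i m)) = gam (minn n m) u;
  gauge0 : forall u, u 0%N = 0 -> gam 0%N u = 0;
  gauge_sqr_le : forall (g : nat -> T -> R) (c : R), mart P F g ->
    {ae P, forall x, g 0%N x = 0} ->
    (forall n, {ae P, forall x, gam n (g ^~ x) <= c}) ->
    forall n, \int[P]_x (g n x ^+ 2) <= c ^+ 2;
  gauge_le_top : forall n f x, ((gam n (f ^~ x))%:E <= Top f x)%E;
  top_le_gauge : forall f x y,
    (forall n, ((gam n (f ^~ x))%:E <= y)%E) -> (Top f x <= y)%E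
}.

Lemma gauge_sum Top gam (I : Type) (s : seq I) n (u : I -> nat -> R) : gauge Top gam ->
  gam n (fun i => \sum_(k <- s) u k i) <= \sum_(k <- s) gam n (u k).
Proof.
move=> hg; elim: s => [|k s IH].
  rewrite big_nil (_ : (fun _ => _) = (fun i => 0 * 0)).
    by rewrite (gaugeZ hg n 0 (fun=> 0)) normr0 mul0r.
  by apply/funext => i; rewrite big_nil mul0r.
rewrite big_cons; under eq_fun do rewrite big_cons.
by apply: le_trans (gaugeD hg _ _ _) _; rewrite lerD2l.
Qed.

Lemma gaugeB Top gam n (u v : nat -> R) : gauge Top gam ->
  gam n (fun i => u i - v i) <= gam n u + gam n v.
Proof.
move=> hg; have := gaugeD hg n u (fun i => -1 * v i).
rewrite (gaugeZ hg) normrN1 mul1r.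
by under eq_fun do rewrite mulN1r.
Qed.

Lemma Rintegral_ae_le_cst (f : T -> R) (c : R) : measurable_fun setT f ->
  0 <= c -> (forall x, 0 <= f x) -> {ae P, forall x, f x <= c} ->
  \int[P]_x f x <= c.
Proof.
move=> mf c0 f0 fc.
have fcn : {ae P, forall x, `|f x| <= c}.
  by apply: filterS fc => x fcx; rewrite ger0_norm.
have iF := ae_bounded_integrable mf fcn.
rewrite -lee_fin /Rintegral fineK; last exact: integrable_fin_num.
have -> : c%:E = (\int[P]_x (c%:E))%E.
  transitivity (c%:E * P setT)%E; first by rewrite probability_setT mule1.
  by rewrite -integral_cst.
apply: ae_le_lower_integral => //.
Qed.

Definition gamM (n : nat) (u : nat -> R) : R := `|u n|.

Lemma gauge_Mf : is_filtration F -> gauge (@Mf _ T R) gamM.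
Proof.
move=> hF; split.
- by move=> n u; exact: normr_ge0.
- by move=> n u v; exact: ler_normD.
- by move=> n c u; exact: normrM.
- by move=> n u v uv; apply: cvg_norm; exact: uv.
- move=> n f Gf; apply: (Gmeasurable_comp (filtration_sigma hF n)) (Gf n).
  exact: normr_measurable.
- move=> n u _; rewrite /gamM -[leLHS]mul1r ler_wpM2r//.
  by rewrite ler1n.
- by [].
- by move=> u u0; rewrite /gamM u0 normr0.
- move=> g c mg _ gc n.
  have mgn := filtration_measurable_fun hF (mg.1 n).1.
  apply: Rintegral_ae_le_cst => [||x|]; [exact: measurable_funX|exact: sqr_ge0|exact: sqr_ge0|].
  apply: filterS (gc n) => x; rewrite /gamM => gcx.
  by rewrite -real_normK ?num_real// ler_pXn2r// nnegrE// (le_trans _ gcx).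
- by move=> n f x; apply: ereal_sup_ubound; exists n.
- by move=> f x y fy; apply: ge_ereal_sup => _ [n _ <-]; exact: fy.
Qed.

Fixpoint sqsum (n : nat) (u : nat -> R) : R :=
  if n is m.+1 then sqsum m u + (u m.+1 - u m) ^+ 2 else 0.

Definition gamS (n : nat) (u : nat -> R) : R := Num.sqrt (sqsum n u).

Lemma sqsum_ge0 n u : 0 <= sqsum n u.
Proof. by elim: n => //= n IH; rewrite addr_ge0// sqr_ge0. Qed.

Lemma sqr_gamS n u : gamS n u ^+ 2 = sqsum n u.
Proof. by rewrite sqr_sqrtr// sqsum_ge0. Qed.

Lemma gamS_le n u (t : R) : 0 <= t -> (gamS n u <= t) = (sqsum n u <= t ^+ 2).
Proof. by move=> t0; rewrite -sqr_gamS ler_pXn2r// nnegrE sqrtr_ge0. Qed.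

Lemma sqsumE n u :
  (\sum_(1 <= i < n.+1) ((u i - u i.-1) ^+ 2)%:E = (sqsum n u)%:E)%E.
Proof.
elim: n => [|n IH]; first by rewrite big_geq.
by rewrite big_nat_recr//= IH.
Qed.

(** Minkowski's inequality, one increment at a time. Each step is the triangle inequality in the
    plane, which reduces to x y + a b <= A B with A^2 = x^2 + a^2 and B^2 = y^2 + b^2, that is, to
    (x b - y a)^2 >= 0. *)
Lemma gamSD n u v : gamS n (fun i => u i + v i) <= gamS n u + gamS n v.
Proof.
have g0 m w : 0 <= gamS m w by exact: sqrtr_ge0.
elim: n => [|n IH]; first by rewrite /gamS /= sqrtr0 addr0.
rewrite gamS_le ?addr_ge0//=.
have -> : u n.+1 + v n.+1 - (u n + v n) = (u n.+1 - u n) + (v n.+1 - v n) by ring.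
move: (sqr_gamS n.+1 u) (sqr_gamS n.+1 v) => /=; rewrite -!sqr_gamS.
move: (u n.+1 - u n) (v n.+1 - v n) => a b.
move: (gamS n _) (gamS n u) (gamS n v) (gamS n.+1 u) (gamS n.+1 v)
  (g0 n (fun i => u i + v i)) (g0 n u) (g0 n v) (g0 n.+1 u) (g0 n.+1 v) IH.
move=> z x y A B z0 x0 y0 A0 B0 zxy A2 B2.
have z2 : z ^+ 2 <= (x + y) ^+ 2 by rewrite ler_pXn2r// nnegrE addr_ge0.
suff : x * y + a * b <= A * B by nra.
have [s0|s0] := leP (x * y + a * b) 0; first by rewrite (le_trans s0)// mulr_ge0.
rewrite -(@ler_pXn2r _ 2)//; [|by rewrite nnegrE ltW|by rewrite nnegrE mulr_ge0].
rewrite exprMn A2 B2 -subr_ge0.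
by rewrite (_ : _ - _ = (x * b - y * a) ^+ 2) ?sqr_ge0//; ring.
Qed.

Lemma sqsum_stop n m u : sqsum n (fun i => u (minn i m)) = sqsum (minn n m) u.
Proof.
elim: n => [|n IH]; first by rewrite min0n.
rewrite /= IH; have [nm|mn] := ltnP n m.
  by rewrite (minn_idPl nm).
by rewrite (minn_idPr (leqW mn)) subrr expr0n addr0.
Qed.

Lemma gauge_Sf : is_filtration F -> gauge (@Sf _ T R) gamS.
Proof.
move=> hF.
have msq n (f : nat -> T -> R) : (forall i, Gmeasurable (F i) (f i)) ->
    Gmeasurable (F n) (fun x => sqsum n (f ^~ x)).
  move=> Gf; elim: n => [|n IH].
    exact: (Gmeasurable_cst (filtration_sigma hF 0)).
  have sF := filtration_sigma hF n.+1.
  apply: GmeasurableD => //; first exact: (Gmeasurable_filtration_le hF (leqnSn n)).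
  apply: (Gmeasurable_comp sF (h := fun z => z ^+ 2)) => //.
  apply: GmeasurableB => //.
  exact: (Gmeasurable_filtration_le hF (leqnSn n)).
(* [u n] is the sum of its increments, each at most [gamS n u] in absolute value. The bound is crude
   but suffices for integrability at each fixed time. *)
have norm_le n u : u 0%N = 0 -> `|u n| <= n.+1%:R * gamS n u.
  move=> u0; elim: n => [|n IH]; first by rewrite u0 normr0 /gamS /= sqrtr0 mulr0.
  have le1 : gamS n u <= gamS n.+1 u.
    by rewrite /gamS ler_wsqrtr//= lerDl sqr_ge0.
  have le2 : `|u n.+1 - u n| <= gamS n.+1 u.
    by rewrite -sqrtr_sqr /gamS ler_wsqrtr//= lerDr sqsum_ge0.
  have -> : u n.+1 = u n + (u n.+1 - u n) by rewrite addrC subrK.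
  apply: le_trans (ler_normD _ _) _.
  rewrite -[n.+2]addn1 natrD mulrDl mul1r lerD//.
  by apply: le_trans IH _; rewrite ler_wpM2l.
split.
- by move=> n u; exact: sqrtr_ge0.
- exact: gamSD.
- move=> n c u; rewrite /gamS.
  have -> : sqsum n (fun i => c * u i) = c ^+ 2 * sqsum n u.
    by elim: n => [|n IH] /=; [rewrite mulr0|rewrite IH; ring].
  by rewrite sqrtrM ?sqr_ge0// sqrtr_sqr.
- move=> n u v uv; apply: continuous_cvg; first exact: sqrt_continuous.
  elim: n => [|n IH] /=; first exact: cvg_cst.
  apply: cvgD => //.
  have duv : u N n.+1 - u N n @[N --> \oo] --> v n.+1 - v n by apply: cvgB; exact: uv.
  by rewrite !expr2; under eq_fun do rewrite expr2; exact: cvgM.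
- move=> n f Gf.
  apply: (Gmeasurable_comp (filtration_sigma hF n)) (msq n f Gf).
  by apply: continuous_measurable_fun; exact: sqrt_continuous.
- exact: norm_le.
- by move=> n m u; rewrite /gamS sqsum_stop.
- by move=> u _; rewrite /gamS /= sqrtr0.
- move=> g c mg g0 gc.
  have [gm gE] := mg.
  have mgn n := filtration_measurable_fun hF (gm n).1.
  have gb n : {ae P, forall x, `|g n x| <= n.+1%:R * c}.
    apply: filterS2 g0 (gc n) => x g0x gcx.
    by apply: le_trans (norm_le _ (g ^~ x) g0x) _; rewrite ler_wpM2l.
  have msqn n : measurable_fun setT (fun x => sqsum n (g ^~ x)).
    by apply: (filtration_measurable_fun hF (n := n)); apply: msq => i; exact: (gm i).1.
  have sqc n : {ae P, forall x, sqsum n (g ^~ x) <= c ^+ 2}.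
    apply: filterS (gc n) => x gcx; rewrite -gamS_le//.
    by apply: le_trans gcx; exact: sqrtr_ge0.
  have isq n : P.-integrable setT (EFin \o (fun x => sqsum n (g ^~ x))).
    apply: (@ae_bounded_integrable _ _ _ _ _ (c ^+ 2)) => //.
    by apply: filterS (sqc n) => x; rewrite ger0_norm ?sqsum_ge0.
  (* By orthogonality the second moments of the increments add up, starting from g_0 = 0. *)
  have sqE n : \int[P]_x sqsum n (g ^~ x) = \int[P]_x (g n x ^+ 2).
    elim: n => [|n IH].
      rewrite /Rintegral; congr fine; apply: ae_eq_integral => //.
      - by apply/measurable_EFinP; exact: measurable_cst.
      - by apply/measurable_EFinP; exact: measurable_funX.
      - by apply: filterS g0 => x g0x _ /=; rewrite g0x expr0n.
    rewrite /= RintegralD//; last first.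
      have db : {ae P, forall x, `|g n.+1 x - g n x| <= n.+2%:R * c + n.+1%:R * c}.
        apply: filterS2 (gb n.+1) (gb n) => x h1 h2.
        by apply: le_trans (ler_normB _ _) _; exact: lerD.
      have mdn : measurable_fun setT (fun x => g n.+1 x - g n x) by exact: measurable_funB.
      exact: (ae_bounded_mul_integrable mdn mdn db db).
    by rewrite IH (mart_increment_sqr hF mg gb (leqnSn n)) addrC subrK.
  move=> n; rewrite -sqE; apply: Rintegral_ae_le_cst => // [|x]; [exact: sqr_ge0|exact: sqsum_ge0].
- move=> n f x; rewrite /gamS -powR12_sqrt ?sqsum_ge0// -poweR_EFin.
  have s0 : (0 <= \sum_(1 <= i <oo) ((f i x - f i.-1 x) ^+ 2)%:E)%E.
    by apply: nneseries_ge0 => i _ _; rewrite lee_fin sqr_ge0.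
  apply: gt0_ler_poweR; rewrite ?invr_ge0//.
  - by rewrite in_itv /= leey lee_fin sqsum_ge0.
  - by rewrite in_itv /= leey s0.
  - rewrite -(sqsumE n (f ^~ x)); apply: nneseries_lim_ge => i _ _.
    by rewrite lee_fin sqr_ge0.
- move=> f x y fy; rewrite /Sf.
  have y0 : (0 <= y)%E by apply: le_trans (fy 0%N); rewrite lee_fin sqrtr_ge0.
  move: y y0 fy => [t| |]; last 2 first.
  - by move=> _ _; exact: leey.
  - by [].
  rewrite lee_fin => t0 fy.
  have s0 : (0 <= \sum_(1 <= i <oo) ((f i x - f i.-1 x) ^+ 2)%:E)%E.
    by apply: nneseries_ge0 => i _ _; rewrite lee_fin sqr_ge0.
  have st : (\sum_(1 <= i <oo) ((f i x - f i.-1 x) ^+ 2)%:E <= (t ^+ 2)%:E)%E.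
    apply: lime_le.
      by apply: is_cvg_nneseries => i _ _; rewrite lee_fin sqr_ge0.
    apply: nearW => -[|n]; first by rewrite big_geq// lee_fin sqr_ge0.
    rewrite (sqsumE n (f ^~ x)) lee_fin -gamS_le//.
    by rewrite -lee_fin; exact: fy.
  have -> : t%:E = ((t ^+ 2)%:E `^ 2^-1)%E.
    by rewrite poweR_EFin powR12_sqrt ?sqr_ge0// sqrtr_sqr ger0_norm.
  apply: gt0_ler_poweR => //.
  - by rewrite in_itv /= leey s0.
  - by rewrite in_itv /= leey lee_fin sqr_ge0.
Qed.

End gauges.

(** * Atomic sums dominate the maximal operators *)

Section atomic_upper_bound.
Context {d : measure_display} {T : measurableType d} {R : realType}.
Variables (P : probability T R) (F : nat -> set (set T)).
Variable E : nat -> (T -> R) -> T -> R.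
Variable phi : T -> R -> R.
Hypothesis hphi : MO_function P phi.

Lemma MO_le x (s t : R) : 0 <= s -> s <= t -> phi x s <= phi x t.
Proof. by case: hphi => -[h _] _ _ _ _; exact: h. Qed.

Lemma MO0 x : phi x 0 = 0.
Proof. by case: hphi => -[_ h]. Qed.

Lemma MO_ge0 x (t : R) : 0 <= t -> 0 <= phi x t.
Proof. by move=> t0; rewrite -(MO0 x); exact: MO_le. Qed.

Lemma phie_ge0 x (y : \bar R) : (0 <= y)%E -> (0 <= phie phi x y)%E.
Proof. by case: y => // t t0; rewrite /= lee_fin MO_ge0. Qed.

Lemma phie_le x (y z : \bar R) :
  (0 <= y)%E -> (y <= z)%E -> (phie phi x y <= phie phi x z)%E.
Proof.
case: y z => [s| |] [t| |] //=; rewrite ?lee_fin ?leey//.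
exact: MO_le.
Qed.

Lemma Lphi_norm_ge0 (g : T -> \bar R) : (0 <= Lphi_norm P phi g)%E.
Proof. by apply: le_ereal_inf_tmp => _ [l [/ltW l0 _] <-]; rewrite lee_fin. Qed.

Lemma Lphi_norm_le (g h : T -> \bar R) :
  (forall x, 0 <= g x)%E -> (forall x, 0 <= h x)%E ->
  {ae P, forall x, (g x <= h x)%E} -> (Lphi_norm P phi g <= Lphi_norm P phi h)%E.
Proof.
move=> g0 h0 gh; apply: le_ereal_inf_tmp => _ [l [l0 hl] <-].
apply: ereal_inf_lbound; exists l => //; split => //.
have li : (0 <= (l^-1)%:E)%E by rewrite lee_fin invr_ge0 ltW.
apply: le_trans hl; apply: ae_le_lower_integral.
- by move=> x; apply: phie_ge0; exact: mule_ge0.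
- by move=> x; apply: phie_ge0; exact: mule_ge0.
- apply: filterS gh => x ghx; apply: phie_le; first exact: mule_ge0.
  exact: lee_wpmul2r.
Qed.

(** For z = x and z = y the ratio z / (x + y) is at most 1, so raising it to the power [r <= 1] does
    not decrease it; the two ratios sum to 1. *)
Lemma powRD_le (x y r : R) : 0 <= x -> 0 <= y -> 0 < r <= 1 ->
  (x + y) `^ r <= x `^ r + y `^ r.
Proof.
move=> x0 y0 /andP[r0 r1].
have [s0|s0] := eqVneq (x + y) 0.
  by rewrite s0 powR0 ?gt_eqF// addr_ge0// powR_ge0.
have sp : 0 < x + y by rewrite lt_def s0 addr_ge0.
have le_pow (z : R) : 0 <= z -> z <= x + y -> z / (x + y) * (x + y) `^ r <= z `^ r.
  move=> z0 zs; have {2}-> : z = z / (x + y) * (x + y) by rewrite divfK.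
  have u0 : 0 <= z / (x + y) by rewrite divr_ge0// ltW.
  rewrite powRM// ?(ltW sp)// ler_wpM2r ?powR_ge0//.
  have [->|un0] := eqVneq (z / (x + y)) 0; first exact: powR_ge0.
  by apply: ger1_powR => //; rewrite lt_def un0 u0 ler_pdivrMr// mul1r.
have := lerD (le_pow _ x0 _) (le_pow _ y0 _).
rewrite -mulrDl -mulrDl divff// mul1r; apply.
- by rewrite lerDl.
- by rewrite lerDr.
Qed.

Lemma poweRD_le (x y : \bar R) (r : R) : (0 <= x)%E -> (0 <= y)%E -> 0 < r <= 1 ->
  ((x + y) `^ r <= x `^ r + y `^ r)%E.
Proof.
move=> x0 y0 hr; have /andP[r0 _] := hr.
have rn0 : r != 0 by rewrite gt_eqF.
case: x y x0 y0 => [x| |] [y| |] // x0 y0.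
- by rewrite -EFinD !poweR_EFin -EFinD lee_fin; apply: powRD_le; rewrite -?lee_fin.
- by rewrite addey// poweRyr// addey// -ltNye (lt_le_trans (ltNy0 _))// poweR_ge0.
- by rewrite addye// poweRyr// addye// -ltNye (lt_le_trans (ltNy0 _))// poweR_ge0.
- by rewrite addye// poweRyr// addye.
Qed.

Lemma poweR_sum_le (I : Type) (s : seq I) (y : I -> \bar R) (r : R) :
  (forall i, 0 <= y i)%E -> 0 < r <= 1 ->
  (\sum_(i <- s) y i <= (\sum_(i <- s) (y i) `^ r) `^ (r^-1))%E.
Proof.
move=> y0 hr; have /andP[r0 _] := hr.
have s0 t : (0 <= \sum_(i <- t) y i)%E by exact: sume_ge0.
have -> : (\sum_(i <- s) y i = ((\sum_(i <- s) y i) `^ r) `^ (r^-1))%E.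
  by rewrite -poweRrM divff ?gt_eqF// poweRe1.
apply: gt0_ler_poweR.
- by rewrite invr_ge0 ltW.
- by rewrite in_itv /= leey poweR_ge0.
- by rewrite in_itv /= leey sume_ge0// => i _; exact: poweR_ge0.
elim: s => [|i s IH]; first by rewrite !big_nil poweR0r ?gt_eqF.
rewrite !big_cons; apply: le_trans (poweRD_le _ _ hr) _ => //.
exact: leeD2l.
Qed.

Lemma sum_symmetric_le_esum (y : int -> \bar R) (N : nat) :
  (\sum_(i < (2 * N).+1) y (i%:Z - N%:Z)%R <= \esum_(k in [set: int]) y k)%E.
Proof.
pose s := [seq (i%:Z - N%:Z : int) | i <- iota 0 (2 * N).+1].
have us : uniq s.
  by rewrite map_inj_uniq ?iota_uniq// => i j /addIr [].
apply: esum_ge; exists [set` s]; first by split => //; exact: finite_seq.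
rewrite -fsbig_seq// /s big_map.
by rewrite -[X in iota _ X]subn0 -/(index_iota 0 _) big_mkord.
Qed.

Lemma ae_forall_int (Q : int -> T -> Prop) :
  (forall k, {ae P, forall x, Q k x}) -> {ae P, forall x, forall k, Q k x}.
Proof.
move=> aeQ.
have Qn : {ae P, forall x, forall n, Q (odflt 0 (choice.unpickle n)) x}.
  by apply: ae_foralln => n; exact: aeQ.
by apply: filterS Qn => x Qx k; have := Qx (choice.pickle k); rewrite choice.pickleK.
Qed.

Lemma ae_top_le_atomic Top gam f mu a nu (r : R) : gauge P F Top gam ->
  0 < r <= 1 -> atomic_decomp P F E phi Top f mu a nu ->
  {ae P, forall x, (Top f x <=
    (\esum_(k in [set: int])
       (((mu k)%:E * indic_e (Bnu (nu k)) x
          * (Lphi_norm P phi (indic_e (Bnu (nu k))))^-1) `^ r)) `^ (r^-1))%E}.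
Proof.
move=> hg hr [mu0 ha hcvg].
have A1 : {ae P, forall x, forall n k, nu_ge (nu k) n x -> E n (a k) x = 0}.
  apply: ae_foralln => n; apply: ae_forall_int => k.
  by have [_ _ _ h _] := ha k; exact: h.
have A2 : {ae P, forall x, forall k, Bnu (nu k) x ->
    (Top (fun n => E n (a k)) x <= (Lphi_norm P phi (indic_e (Bnu (nu k))))^-1)%E}.
  by apply: ae_forall_int => k; have [_ _ _ _ h] := ha k.
have A3 := ae_foralln hcvg.
apply: filterS3 A1 A2 A3 => x A1 A2 A3.
set q := fun k => ((Lphi_norm P phi (indic_e (Bnu (nu k))))^-1)%E.
have q0 k : (0 <= q k)%E by rewrite /q inve_ge0 Lphi_norm_ge0.
set y := fun k => ((mu k)%:E * indic_e (Bnu (nu k)) x * q k)%E.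
have y0 k : (0 <= y k)%E.
  by rewrite /y !mule_ge0// lee_fin ?mu0// indicE.
have gy n k : ((gam n (fun i => mu k * E i (a k) x))%:E <= y k)%E.
  rewrite (gaugeZ hg) ger0_norm ?mu0// /y /indic_e indicE.
  case: (boolP (x \in Bnu (nu k))) => xB.
    rewrite mule1 EFinM lee_wpmul2l ?lee_fin ?mu0//.
    apply: le_trans (A2 k _); last exact: set_mem xB.
    exact: (gauge_le_top hg n (fun n => E n (a k)) x).
  (* Off [Bnu (nu k)] the stopping time is infinite, so the whole martingale of the atom vanishes.
     Zero is written [0 * 0] so that homogeneity of the seminorm applies. *)
  have Ea0 : (fun i => E i (a k) x) = (fun i => 0 * 0).
    apply/funext => i; rewrite mul0r; apply: A1.
    move: xB; rewrite notin_setE /Bnu /= /nu_ge.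
    by case: (nu k x) => [m []|].
  by rewrite Ea0 (gaugeZ hg n 0 (fun=> 0)) normr0 mul0r mulr0 mule0 mul0e.
apply: (top_le_gauge hg) => n.
have cvgn : gam n (fun j => \sum_(i < (2 * N).+1) mu (i%:Z - N%:Z) * E j (a (i%:Z - N%:Z)) x)
    @[N --> \oo] --> gam n (f ^~ x).
  by apply: (gauge_cvg hg) => j; exact: A3.
set S := (X in (_ <= X)%E).
have Nle N : ((gam n (fun j => \sum_(i < (2 * N).+1)
    mu (i%:Z - N%:Z) * E j (a (i%:Z - N%:Z)) x))%:E <= S)%E.
  apply: (@le_trans _ _ (\sum_(i < (2 * N).+1) y (i%:Z - N%:Z)%R)%E).
    apply: (@le_trans _ _ (\sum_(i < (2 * N).+1)
        gam n (fun j => mu (i%:Z - N%:Z) * E j (a (i%:Z - N%:Z)) x))%:E).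
      by rewrite lee_fin; exact: (gauge_sum _ _ _ hg).
    by rewrite -sumEFin; apply: lee_sum => i _; exact: gy.
  apply: le_trans (poweR_sum_le _ _ hr) _ => //.
  apply: gt0_ler_poweR.
  - by case/andP: hr => r0 _; rewrite invr_ge0 ltW.
  - by rewrite in_itv /= leey sume_ge0// => i _; exact: poweR_ge0.
  - by rewrite in_itv /= leey esum_ge0// => i _; exact: poweR_ge0.
  - exact: (sum_symmetric_le_esum (fun k => (y k) `^ r)%E).
have S0 : (0 <= S)%E by exact: poweR_ge0.
move: S S0 Nle => [S| |] // _ Nle; last by rewrite leey.
rewrite lee_fin; apply: (cvgr_to_le cvgn); apply: nearW => N.
by rewrite -lee_fin; exact: Nle.
Qed.

Lemma Lphi_norm_le_at_norm Top gam f (r : R) : gauge P F Top gam -> 0 < r <= 1 ->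
  (Lphi_norm P phi (Top f) <= at_norm P F E phi Top r f)%E.
Proof.
move=> hg hr; apply: le_ereal_inf_tmp => _ [mu [a [nu [had ->]]]].
apply: Lphi_norm_le.
- by move=> x; apply: le_trans (gauge_le_top hg 0 f x); rewrite lee_fin (gauge_ge0 hg).
- by move=> x; exact: poweR_ge0.
- exact: ae_top_le_atomic hg hr had.
Qed.

End atomic_upper_bound.

(** * Hitting times, geometric sums and norms of indicators *)

Section hitting_times.
Context {d : measure_display} {T : measurableType d}.

Definition hit (D : nat -> set T) (x : T) : option nat :=
  if pselect (exists n, `[< D n x >]) is left h then Some (ex_minn h) else None.

Lemma nu_ge_hit (D : nat -> set T) n x :
  nu_ge (hit D) n x <-> (forall m, (m < n)%N -> ~ D m x).
Proof.
rewrite /nu_ge /hit; case: pselect => [h|nh]; last first.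
  by split => // _ m _ Dm; apply: nh; exists m; exact/asboolP.
case: ex_minnP => k /asboolP Dk kmin; split => [nk m mn Dm|nD].
  by have := kmin m (asboolT Dm); rewrite leqNgt (leq_trans mn nk).
by rewrite leqNgt; apply/negP => kn; exact: nD kn Dk.
Qed.

Lemma Bnu_hit (D : nat -> set T) x : Bnu (hit D) x <-> exists n, D n x.
Proof.
rewrite /Bnu /hit /=; case: pselect => [h|nh].
  by split => // _; case: h => n /asboolP Dn; exists n.
by split => // -[n Dn]; exfalso; apply: nh; exists n; exact/asboolP.
Qed.

Lemma notin_Bnu_nu_ge (nu : T -> option nat) n x : ~ Bnu nu x -> nu_ge nu n x.
Proof. by rewrite /Bnu /nu_ge /=; case: (nu x) => // k h; exfalso; exact: h. Qed.

End hitting_times.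

Section hitting_stopping.
Context {d : measure_display} {T : measurableType d} {R : realType}.
Variables (P : probability T R) (F : nat -> set (set T)).
Hypothesis hF : is_filtration F.

Lemma stopping_time_hit (D : nat -> set T) :
  (forall n, F n (D n)) -> stopping_time F (hit D).
Proof.
move=> FD n.
rewrite (_ : [set x | _] = ~` [set x | nu_ge (hit D) n.+1 x]); last first.
  apply/seteqP; split=> x /=; rewrite /nu_ge.
    by move=> [k kn ->]; rewrite ltnNge kn.
  by case: (hit D x) => [k /negP|//]; rewrite -leqNgt => kn; exists k.
rewrite (_ : ~` _ = \bigcup_i (if (i <= n)%N then D i else set0)); last first.
  apply/seteqP; split=> x /=.
    move=> /nu_ge_hit /existsNP[m /not_implyP[mn /contrapT Dm]].
    by exists m => //; rewrite -ltnS mn.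
  by move=> [m _]; case: ifP => // mn Dm /nu_ge_hit /(_ m mn).
apply: sub_bigcup => [|i]; first exact: filtration_sigma.
case: ifPn => [im|_]; first exact: (filtration_le hF im).
by case: (filtration_sigma hF n).
Qed.

Lemma measurable_Bnu (nu : T -> option nat) : stopping_time F nu -> measurable (Bnu nu).
Proof.
move=> st; rewrite (_ : Bnu nu =
    \bigcup_n [set x | exists2 k, (k <= n)%N & nu x = Some k]).
  by apply: bigcup_measurable => n _; exact: (filtration_measurable hF (st n)).
apply/seteqP; split => x; rewrite /Bnu /=.
  by case nux: (nu x) => [k|//] _; exists k => //; exists k.
by move=> [n _ [k _ ->]].
Qed.

Lemma stopped_nu_ge (nu : T -> option nat) (f : nat -> T -> R) n x :
  nu_ge nu n x -> stopped nu f n x = f n x.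
Proof. by rewrite /nu_ge /stopped; case: (nu x) => // k /minn_idPl ->. Qed.

(** Stopping freezes the seminorm at time min(n, nu). A bound valid up to [nu] thus becomes a bound
    for the stopped sequence at all times. *)
Lemma gauge_stopped Top gam (nu : T -> option nat) (f : nat -> T -> R) n x :
  gauge P F Top gam ->
  exists2 m, nu_ge nu m x & gam n (stopped nu f ^~ x) = gam m (f ^~ x).
Proof.
move=> hg; rewrite /stopped /nu_ge; case: (nu x) => [k|]; last by exists n.
by exists (minn n k); [exact: geq_minr|rewrite -(gauge_stop hg n k (f ^~ x))].
Qed.

End hitting_stopping.

Section geometric_sums.
Context {R : realType}.

(** The sum of the geometric series with ratio 2^(-q). *)
Definition geom_cst (q : R) : R := 2 `^ q / (2 `^ q - 1).

Lemma powR2_gt1 (q : R) : 0 < q -> 1 < (2 : R) `^ q.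
Proof.
by move=> q0; rewrite -[ltLHS](powRr0 2) /powR pnatr_eq0 /= ltr_expR ltr_pM2r// ln_gt0// ltr1n.
Qed.

Lemma geom_cst_gt0 (q : R) : 0 < q -> 0 < geom_cst q.
Proof. by move=> /powR2_gt1 Q1; rewrite divr_gt0 ?subr_gt0// (lt_trans _ Q1). Qed.

Lemma powR_exprzS (q : R) (k : int) :
  ((2 : R) ^ (k + 1)) `^ q = 2 `^ q * (2 ^ k) `^ q.
Proof. by rewrite expfzDr ?pnatr_eq0// expr1z mulrC powRM// exprz_ge0. Qed.

Lemma geom_sum_le (q : R) (N M : nat) : 0 < q ->
  \sum_(i < M) ((2 : R) ^ (i%:Z - N%:Z)) `^ q <=
  geom_cst q / 2 `^ q * (2 ^ (M%:Z - N%:Z)) `^ q.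
Proof.
move=> q0; have Q1 := powR2_gt1 q0.
have Qn0 : (2 : R) `^ q != 0 by rewrite gt_eqF// (lt_trans _ Q1).
have Q1n0 : (2 : R) `^ q - 1 != 0 by rewrite gt_eqF// subr_gt0.
elim: M => [|M IH].
  by rewrite big_ord0 mulr_ge0 ?powR_ge0// divr_ge0 ?powR_ge0// ltW// geom_cst_gt0.
rewrite big_ord_recr /=; apply: le_trans (lerD IH (lexx _)) _.
rewrite (_ : M.+1%:Z - N%:Z = (M%:Z - N%:Z) + 1); last by rewrite -addn1 PoszD; ring.
rewrite powR_exprzS le_eqVlt; apply/orP; left; apply/eqP.
rewrite /geom_cst; field.
by rewrite Q1n0 Qn0.
Qed.

(** If the top power is at most [t], all terms may be kept and the geometric sum is controlled by
    the last one; otherwise the top term is absent and induction applies. *)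
Lemma geom_sum_filter_le (q t : R) (N M : nat) : 0 < q -> 0 <= t ->
  \sum_(i < M | (2 : R) ^ (i%:Z - N%:Z) <= t) ((2 : R) ^ (i%:Z - N%:Z)) `^ q <=
  geom_cst q * t `^ q.
Proof.
move=> q0 t0; have Q1 := powR2_gt1 q0.
have Q0 : 0 < (2 : R) `^ q by rewrite (lt_trans _ Q1).
elim: M => [|M IH].
  by rewrite big_ord0 mulr_ge0 ?powR_ge0// ltW// geom_cst_gt0.
rewrite big_mkcond big_ord_recr /= -big_mkcond /=.
case: ifPn => [Mt|_]; last by rewrite addr0.
apply: (@le_trans _ _ (\sum_(i < M.+1) ((2 : R) ^ (i%:Z - N%:Z)) `^ q)).
  rewrite big_ord_recr /= lerD2r big_mkcond /=; apply: ler_sum => i _.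
  by case: ifP => // _; exact: powR_ge0.
apply: le_trans (geom_sum_le _ _ q0) _.
rewrite (_ : M.+1%:Z - N%:Z = (M%:Z - N%:Z) + 1); last by rewrite -addn1 PoszD; ring.
rewrite powR_exprzS mulrA divfK ?gt_eqF//.
apply: ler_wpM2l; first exact/ltW/geom_cst_gt0.
by apply: ge0_ler_powR; rewrite ?nnegrE ?exprz_ge0//; exact: ltW.
Qed.

Lemma geom_sum_seq_le (q t : R) (s : seq int) : 0 < q -> 0 <= t -> uniq s ->
  (forall k, k \in s -> (2 : R) ^ k <= t) ->
  \sum_(k <- s) ((2 : R) ^ k) `^ q <= geom_cst q * t `^ q.
Proof.
move=> q0 t0 us st.
(* A crude bound on all |k|, which puts [s] into the window from -N to N. *)
pose N := (\sum_(k <- s) `|k|)%N.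
have kN k : k \in s -> (`|k| <= N)%N.
  by move=> ks; rewrite /N (bigD1_seq k)//= leq_addr.
pose I := [seq (i%:Z - N%:Z)%R | i <- iota 0 (2 * N).+1].
have uI : uniq I by rewrite map_inj_uniq ?iota_uniq// => i j /addIr [].
have sI : {subset s <= I}.
  move=> k ks; apply/mapP; exists (absz (k + Posz N)); last first.
    rewrite gez0_abs ?addrK//.
    by have := kN _ ks; lia.
  by rewrite mem_iota /=; have := kN _ ks; lia.
have pI : perm_eq s [seq k <- I | k \in s].
  apply: uniq_perm => //; first exact: filter_uniq.
  by move=> k; rewrite mem_filter; case: (boolP (k \in s)) => // /sI ->.
rewrite (perm_big _ pI) big_filter big_map.
apply: le_trans (geom_sum_filter_le N (2 * N).+1 q0 t0).
rewrite -(big_mkord (fun i : nat => (2 : R) ^ (i%:Z - N%:Z) <= t)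
  (fun i : nat => ((2 : R) ^ (i%:Z - N%:Z)) `^ q)) /index_iota subn0.
rewrite big_mkcond [leRHS]big_mkcond /=; apply: ler_sum => i _.
case: ifP => [/st ->//|_]; case: ifP => // _; exact: powR_ge0.
Qed.

Lemma exists_scale_le1 (p c : R) : 0 < p -> 0 <= c ->
  exists2 s, 0 < s < 1 & c * s `^ p <= 1.
Proof.
move=> p0 c0; have c2 : 0 < c + 2 by lra.
(* Then s^p = 1 / (c + 2); adding 2 keeps [s] strictly below 1 even for c = 0. *)
pose s : R := ((c + 2)^-1) `^ (p^-1).
have s0 : 0 < s by rewrite powR_gt0// invr_gt0.
have sp : s `^ p = (c + 2)^-1.
  by rewrite -powRrM mulVf ?gt_eqF// powRr1// invr_ge0 ltW.
exists s; last by rewrite sp ler_pdivrMr// mul1r; lra.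
rewrite s0 /= ltNge; apply/negP => s1.
have : 1 `^ p <= s `^ p.
  by apply: ge0_ler_powR; rewrite ?nnegrE// ltW.
by rewrite powR1 sp leNgt invf_lt1//; apply/negP; rewrite negbK; lra.
Qed.

End geometric_sums.

Section indicator_norm.
Context {d : measure_display} {T : measurableType d} {R : realType}.
Variables (P : probability T R) (phi : T -> R -> R).
Hypothesis hphi : MO_function P phi.

Lemma MO_measurable (t : R) : 0 <= t -> measurable_fun setT (phi ^~ t).
Proof. by case: hphi => _ _ h _ _; exact: h. Qed.

Lemma MO_integrable (t : R) : 0 <= t -> P.-integrable setT (EFin \o (phi ^~ t)).
Proof. by case: hphi => _ _ _ _ h; exact: h. Qed.

Lemma MO_cvgy x : phi x t @[t --> +oo] --> +oo.
Proof. by case: hphi => _ h _ _ _; exact: h. Qed.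

(** By lower type phi(x, s) <= C s^p phi(x, 1) with phi(., 1) integrable, so for small [s] the value
    [s^-1] is admissible in the infimum. *)
Lemma Lphi_norm_indic_fin_num (p : R) (B : set T) : 0 < p -> lower_type phi p ->
  Lphi_norm P phi (indic_e B) \is a fin_num.
Proof.
move=> p0 [C [C0 lt_phi]].
rewrite ge0_fin_numE; last exact: Lphi_norm_ge0.
pose I := \int[P]_x phi x 1.
have I0 : 0 <= I by apply: Rintegral_ge0 => x _; exact: (MO_ge0 hphi).
have CI0 : 0 <= C * I by rewrite mulr_ge0// ltW.
have [s /andP[s0 s1] sp] := exists_scale_le1 p0 CI0.
apply: (@le_lt_trans _ _ (s^-1)%:E); last by rewrite ltry.
apply: ereal_inf_lbound; exists s^-1 => //; split; first by rewrite invr_gt0.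
apply: (@le_trans _ _ (\int[P]_x (C * s `^ p * phi x 1)%:E)%E).
  apply: le_lower_integral => x.
    apply: (phie_ge0 hphi); rewrite mule_ge0// lee_fin ?indicE//.
    by rewrite invrK ltW.
  rewrite /indic_e -EFinM invrK /= lee_fin.
  apply: (@le_trans _ _ (phi x (s * 1))); last by apply: lt_phi => //; rewrite s0.
  apply: (MO_le hphi); rewrite indicE; first by rewrite mulr_ge0// ltW.
  by rewrite mulr1; case: (_ \in _); rewrite ?mul1r ?mul0r// ltW.
under eq_integral do rewrite EFinM.
rewrite ge0_integralZl_EFin//; last 3 first.
- by move=> x _; rewrite lee_fin (MO_ge0 hphi).
- by apply/measurable_EFinP; exact: MO_measurable.
- by rewrite mulr_ge0 ?powR_ge0// ltW.
have -> : (\int[P]_x (phi x 1)%:E)%E = I%:E.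
  by rewrite /I /Rintegral fineK//; apply: integrable_fin_num => //; exact: MO_integrable.
by rewrite -EFinM lee_fin mulrAC.
Qed.

(** A zero norm bounds the integral of phi(., n) over [B] by 1 for every n. As phi tends to infinity
    in [t], monotone convergence forces [B] to be null. *)
Lemma Lphi_norm_indic_eq0 (B : set T) : measurable B ->
  Lphi_norm P phi (indic_e B) = 0%E -> P B = 0%E.
Proof.
move=> mB n0.
have int_le1 (n : nat) : (\int[P]_(x in B) (phi x n%:R)%:E <= 1)%E.
  (* The infimum is 0, so there is an admissible [l] below 1 / (n + 1), and then [l^-1] exceeds
     [n]. *)
  have [_ [l [l0 hl] <-]] : exists2 z, [set l%:E | l in
      [set l : R | 0 < l /\ (\int[P]_x phie phi x (indic_e B x * (l^-1)%:E) <= 1)%E]] z &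
      (z < (n.+1%:R^-1)%:E)%E.
    by apply: ereal_inf_lt; rewrite -/(Lphi_norm P phi (indic_e B)) n0 lte_fin invr_gt0.
  rewrite lte_fin => ln.
  apply: le_trans hl; rewrite integral_mkcond; apply: le_lower_integral => x.
    rewrite /patch; case: ifP => // _; rewrite lee_fin (MO_ge0 hphi)//.
  rewrite /patch /indic_e -EFinM indicE; case: ifP => xB /=; last first.
    by rewrite lee_fin (MO_ge0 hphi)// mul0r.
  rewrite lee_fin mul1r; apply: (MO_le hphi) => //.
  apply: (@le_trans _ _ n.+1%:R); first by rewrite ler_nat.
  by rewrite -[leLHS]invrK lef_pV2 ?posrE ?invr_gt0// ltW.
have := @cvg_monotone_convergence _ _ _ P B mB (fun n x => (phi x n%:R)%:E) _ _ _.
have mphi n : measurable_fun B (fun x => (phi x n%:R)%:E).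
  by apply/measurable_EFinP; apply: measurable_funTS; exact: MO_measurable.
have phi0 n x : B x -> (0 <= (phi x n%:R)%:E)%E.
  by move=> _; rewrite lee_fin (MO_ge0 hphi).
have phind x : B x -> {homo (fun n => (phi x n%:R)%:E) : m n / (m <= n)%N >-> (m <= n)%E}.
  by move=> _ m n mn; rewrite lee_fin; apply: (MO_le hphi) => //; rewrite ler_nat.
move=> /(_ mphi phi0 phind).
have limE x : limn (fun n => (phi x n%:R)%:E) = +oo%E.
  apply/cvg_lim => //; apply/cvgeryP.
  have h := MO_cvgy x; have h2 := @cvgr_idn R.
  exact: (cvg_comp _ _ h2 h).
under [in X in _ --> X]eq_integral do rewrite limE.
rewrite integral_cst// => cvgI.
have : (+oo * P B <= 1)%E.
  rewrite -(cvg_lim _ cvgI)//; apply: lime_le; first by apply/cvg_ex; eexists; exact: cvgI.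
  by apply: nearW => n; exact: int_le1.
apply: contraPP => /eqP PB0.
by rewrite gt0_mulye ?leye_eq// lt_def PB0 measure_ge0.
Qed.

End indicator_norm.

(** * Atoms from stopping times covering the level sets *)

Section stopping_construction.
Context {d : measure_display} {T : measurableType d} {R : realType}.
Variables (P : probability T R) (F : nat -> set (set T)).
Variable E : nat -> (T -> R) -> T -> R.
Variable phi : T -> R -> R.
Hypotheses (hF : is_filtration F) (hE : is_condexp_op P F E).
Hypothesis hphi : MO_function P phi.
Variables (K Rc : R).
Hypotheses (K0 : 0 < K) (Rc0 : 0 < Rc).
Hypothesis hS : forall n t, 0 <= t ->
  {ae P, forall x, K^-1 * phi_n E phi n x t <= phi_n E phi n.+1 x t}.
Hypothesis hR : forall f : nat -> T -> R, martingale P F E f ->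
  (forall n, {ae P, forall x, 0 <= f n x}) ->
  forall n, {ae P, forall x, f n.+1 x <= Rc * f n x}.
Variables (Top : (nat -> T -> R) -> T -> \bar R) (gam : nat -> (nat -> R) -> R).
Hypothesis hg : gauge P F Top gam.
Variable f : nat -> T -> R.
Hypothesis hf : martingale0 P F E f.

Let sF := filtration_sigma hF.
Let mF := filtration_measurable hF.

Definition first_over (lev : R) (n : nat) : set T :=
  [set x | lev < gam n (f ^~ x) /\ forall m, (m < n)%N -> gam m (f ^~ x) <= lev].

Lemma first_over_sub lev n : F n (first_over lev n).
Proof.
have Glt m : F m [set x | lev < gam m (f ^~ x)].
  apply: (Gmeasurable_lt (sF m)); first exact: Gmeasurable_cst.
  by apply: (gauge_measurable hg) => i; exact: (hf.1.1 i).1.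
rewrite (_ : first_over lev n = [set x | lev < gam n (f ^~ x)] `&`
  ~` \bigcup_i (if (i < n)%N then [set x | lev < gam i (f ^~ x)] else set0)).
  apply: sub_setI => //; apply: sub_setC => //; apply: sub_bigcup => // i.
  case: ifPn => [/ltnW im|_]; first exact: (filtration_le hF im).
  by case: (sF n).
apply/seteqP; split => x [ln h]; split => //.
  by move=> [m _] /=; case: ifP => // mn /=; rewrite ltNge h.
move=> m mn; rewrite leNgt; apply/negP => lm; apply: h; exists m => //=.
by rewrite mn.
Qed.

Lemma integrable_indicR (A : set T) : measurable A ->
  P.-integrable setT (EFin \o (\1_A : T -> R)).
Proof.
move=> mA; apply: (@ae_bounded_integrable _ _ _ _ _ 1).
  exact: measurable_indic.
by apply: aeW => x; rewrite indicE; case: (_ \in _); rewrite ?normr1 ?normr0.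
Qed.

(** Regularity applied to the closed martingale of [\1_A], whose value at time [n.+1] is [\1_A]
    itself. *)
Lemma indic_le_condexp n (A : set T) : F n.+1 A ->
  {ae P, forall x, (\1_A x : R) <= Rc * E n (\1_A) x}.
Proof.
move=> FA; have iA := integrable_indicR (mF FA).
have A0 x : 0 <= (\1_A x : R) by rewrite indicE.
have h1 := hR (martingale_condexp hF hE iA) (fun n => condexp_ge0 hF hE n iA A0) n.
have h2 : {ae P, forall x, E n.+1 (\1_A) x = \1_A x}.
  by apply: (condexp_unique hF hE) => //; exact: Gmeasurable_indic.
apply: filterS2 h1 h2 => x h e; apply: le_trans h.
by rewrite le_eqVlt; apply/orP; left; apply/eqP/esym.
Qed.

Definition cover (lev : R) (n : nat) : set T :=
  [set x | Rc^-1 <= E n (\1_(first_over lev n.+1)) x].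

Lemma cover_sub lev n : F n (cover lev n).
Proof.
apply: (Gmeasurable_le (sF n)); first exact: Gmeasurable_cst.
by have [] := hE n (integrable_indicR (mF (first_over_sub lev n.+1))).
Qed.

Lemma first_over_cover lev n :
  {ae P, forall x, first_over lev n.+1 x -> cover lev n x}.
Proof.
apply: filterS (indic_le_condexp (first_over_sub lev n.+1)) => x h fx.
move: h; rewrite {1}indicE mem_set// /cover /= => h.
by rewrite -[leLHS]mul1r ler_pdivrMr// mulrC.
Qed.

(** Versions of conditional expectations are nonnegative only a.e.; this truncation makes them
    nonnegative everywhere at no cost. *)
Lemma integral_max0 (u : T -> R) (A : set T) : measurable A ->
  measurable_fun setT u -> {ae P, forall x, 0 <= u x} ->
  (\int[P]_(x in A) (Num.max (u x) 0)%:E = \int[P]_(x in A) (u x)%:E)%E.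
Proof.
move=> mA mu u0; apply: ae_eq_integral => //.
- by apply/measurable_EFinP; apply: measurable_funTS; exact: measurable_maxr.
- by apply/measurable_EFinP; exact: measurable_funTS.
- by apply: filterS u0 => x u0 _ /=; congr EFin; exact/max_idPl.
Qed.

(* On [cover lev n] the factor [Rc * E n 1_A] is at least 1; moving the conditional expectation
   from [1_A] to [phi] costs [Rc], and passing from time [n] to time [n.+1] costs [K]. *)
Lemma integral_cover_le lev n (t : R) : 0 <= t ->
  (\int[P]_(x in cover lev n) (phi x t)%:E <=
   (Rc * K)%:E * \int[P]_(x in first_over lev n.+1) (phi x t)%:E)%E.
Proof.
move=> t0; set A := first_over lev n.+1; set B := cover lev n.
have FA : F n.+1 A by exact: first_over_sub.
have FB : F n B by exact: cover_sub.
have mA := mF FA; have mB := mF FB.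
have iA := integrable_indicR mA.
have iphi := MO_integrable hphi t0.
pose pn := E n (phi ^~ t); pose pn1 := E n.+1 (phi ^~ t); pose eA := E n (\1_A).
have [Gpn ipn pnE] := hE n iphi; rewrite -/pn in Gpn ipn pnE.
have [Gpn1 ipn1 pn1E] := hE n.+1 iphi; rewrite -/pn1 in Gpn1 ipn1 pn1E.
have [GeA ieA eAE] := hE n iA; rewrite -/eA in GeA ieA eAE.
have phi0 x : 0 <= phi x t by exact: (MO_ge0 hphi).
have pn0 : {ae P, forall x, 0 <= pn x} := condexp_ge0 hF hE n iphi phi0.
have pn10 : {ae P, forall x, 0 <= pn1 x} := condexp_ge0 hF hE n.+1 iphi phi0.
have A0 x : 0 <= (\1_A x : R) by rewrite indicE.
have eA0 : {ae P, forall x, 0 <= eA x} := condexp_ge0 hF hE n iA A0.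
have mpn := filtration_measurable_fun hF Gpn.
have mpn1 := filtration_measurable_fun hF Gpn1.
have meA := filtration_measurable_fun hF GeA.
pose m0 (u : T -> R) x := Num.max (u x) 0.
have m0_ge0 u x : 0 <= m0 u x by rewrite /m0 le_max lexx orbT.
have mm0 u : measurable_fun setT u -> measurable_fun setT (m0 u).
  by move=> mu; exact: measurable_maxr.
have Gm0 : Gmeasurable (F n) (m0 pn).
  apply: (Gmeasurable_comp (sF n) (h := fun z => Num.max z 0)) Gpn.
  exact: measurable_maxr.
(* The cover belongs to [F n], so phi may be replaced by its conditional expectation [pn]. *)
rewrite -pnE// -integral_max0// [leLHS]integral_set_indicM.
apply: (@le_trans _ _ (\int[P]_x (Rc * (m0 eA x * m0 pn x))%:E)%E).
  apply: le_lower_integral => x; first by rewrite lee_fin mulr_ge0 ?indicE//; exact: m0_ge0.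
  rewrite lee_fin mulrA mulrC indicE; case: (boolP (x \in B)) => xB; last first.
    by rewrite mul0r !mulr_ge0// ltW.
  apply: ler_wpM2r; first exact: m0_ge0.
  move/set_mem: xB; rewrite /B /cover /= -/eA => xB.
  rewrite -(divff (lt0r_neq0 Rc0)) ler_wpM2l ?(ltW Rc0)//.
  by apply: (le_trans xB); rewrite /m0 le_max lexx.
under eq_integral do rewrite EFinM.
rewrite ge0_integralZl_EFin//; last 3 first.
- by move=> x _; rewrite lee_fin mulr_ge0.
- by apply/measurable_EFinP; apply: measurable_funM; exact: mm0.
- exact: ltW.
rewrite EFinM -muleA lee_wpmul2l ?lee_fin ?(ltW Rc0)//.
(* [m0 pn] is [F n]-measurable, so the conditional expectation [eA] can be undone. *)
have -> : (\int[P]_x (m0 eA x * m0 pn x)%:E = \int[P]_x (\1_A x * m0 pn x)%:E)%E.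
  apply: (@integral_mul_sub _ _ _ P (F n)) => //.
  - exact: mm0.
  - by move=> D FD; rewrite integral_max0 ?eAE//; exact: mF FD.
apply: (@le_trans _ _ (\int[P]_(x in A) (K * m0 pn1 x)%:E)%E).
  rewrite [leRHS]integral_set_indicM; apply: ae_le_lower_integral.
  - by move=> x; rewrite lee_fin mulr_ge0.
  - by move=> x; rewrite lee_fin !mulr_ge0// ltW.
  - apply: filterS3 (hS n t0) pn0 pn10 => x; rewrite /phi_n -/pn -/pn1 => h p0 p10.
    rewrite lee_fin mulrC ler_wpM2r//.
    rewrite /m0 (max_idPl p0) (max_idPl p10).
    by move: h; rewrite mulrC ler_pdivrMr// mulrC.
under eq_integral do rewrite EFinM.
rewrite ge0_integralZl_EFin//; last 3 first.
- by move=> x _; rewrite lee_fin.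
- by apply/measurable_EFinP; apply: measurable_funTS; exact: mm0.
- exact: ltW.
by rewrite integral_max0// pn1E.
Qed.

(* Taking all levels above [2 ^ k] makes [nuk] nondecreasing in [k] and leaves
   [sup_k 2 ^ k * \1_(Bnu (nuk k))] unchanged. *)
Definition hit_region (k : int) (n : nat) : set T :=
  \bigcup_i cover (2 ^ (k + i%:Z)) n.

Definition nuk (k : int) : T -> option nat := hit (hit_region k).

Lemma stopping_nuk k : stopping_time F (nuk k).
Proof.
apply: (stopping_time_hit hF) => n; apply: sub_bigcup => // i.
exact: cover_sub.
Qed.

(** Shifting the index of the union embeds the hit region of level [k + 1] into that of level
    [k]. *)
Lemma nuk_mono k n x : nu_ge (nuk k) n x -> nu_ge (nuk (k + 1)) n x.
Proof.
move=> /nu_ge_hit h; apply/nu_ge_hit => m mn [i _ ci]; apply: (h m mn).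
exists i.+1 => //; rewrite (_ : k + _ = k + 1 + i%:Z)//.
by rewrite -addn1 PoszD; ring.
Qed.

Definition levels_ok (x : T) := f 0%N x = 0 /\
  forall k m, nu_ge (nuk k) m x -> gam m (f ^~ x) <= 2 ^ k.

(** If the seminorm exceeds 2^k by time [m], it does so first at some [j.+1 <= m], time 0 being
    excluded by f_0 = 0. The cover catches this one step earlier, so [nuk k] is at most [j] and
    hence below [m]. *)
Lemma ae_levels_ok : {ae P, forall x, levels_ok x}.
Proof.
have cov : {ae P, forall x, forall (k : int) n,
    first_over (2 ^ k) n.+1 x -> cover (2 ^ k) n x}.
  apply: ae_forall_int => k; apply: ae_foralln => n; exact: first_over_cover.
apply: filterS2 hf.2 cov => x f0 cx; split => // k m num.
rewrite leNgt; apply/negP => gm.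
have ex : exists j, 2 ^ k < gam j (f ^~ x) by exists m.
case: (ex_minnP ex) => -[|j] gj jmin.
  by move: gj; rewrite (gauge0 hg) // ltNge exprz_ge0.
have jm : (j < m)%N by exact: jmin.
move: num => /nu_ge_hit /(_ j jm); apply; exists 0%N => //; rewrite addr0.
apply: cx; split => // i ij; rewrite leNgt; apply/negP => gi.
by have := jmin _ gi; rewrite leqNgt ij.
Qed.

Definition incr (k : int) (n : nat) (x : T) :=
  stopped (nuk (k + 1)) f n x - stopped (nuk k) f n x.

Lemma gam_stopped_le k n x : levels_ok x ->
  gam n (stopped (nuk k) f ^~ x) <= 2 ^ k.
Proof.
move=> [_ ok]; have [m num ->] := gauge_stopped (nuk k) f n x hg.
exact: ok.
Qed.

(** The factor 3 comes from 2^(k+1) + 2^k, the bounds for the two stopped sequences. *)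
Lemma gam_incr_le k n x : levels_ok x -> gam n (incr k ^~ x) <= 3 * 2 ^ k.
Proof.
move=> ok; apply: le_trans (gaugeB n _ _ hg) _.
apply: le_trans (lerD (gam_stopped_le (k + 1) n ok) (gam_stopped_le k n ok)) _.
by rewrite expfzDr ?pnatr_eq0// expr1z; lra.
Qed.

Lemma stopped0 (nu : T -> option nat) x : stopped nu f 0 x = f 0%N x.
Proof. by rewrite /stopped; case: (nu x) => // k; rewrite min0n. Qed.

Lemma incr_eq0 k n x : nu_ge (nuk k) n x -> incr k n x = 0.
Proof.
move=> h; rewrite /incr stopped_nu_ge; last exact: nuk_mono.
by rewrite stopped_nu_ge// subrr.
Qed.

(** The uniform bound on the seminorm bounds the increment at each fixed time, with a factor growing
    in n, and its second moments uniformly in n. This is what closing the martingale requires. *)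
Lemma incr_closed k : exists b : T -> R, [/\ measurable_fun setT b,
  P.-integrable setT (EFin \o b) & forall n, {ae P, forall x, E n b x = incr k n x}].
Proof.
have mf := martingale_mart hF hE hf.1.
have mincr : mart P F (incr k).
  by apply: (martB hF); apply: (mart_stopped hF) => //; exact: stopping_nuk.
apply: (@mart_closed _ _ _ P F E hF hE (incr k)
  (fun n => n.+1%:R * (3 * 2 ^ k)) ((3 * 2 ^ k) ^+ 2)) => //.
- move=> n; apply: filterS ae_levels_ok => x ok.
  apply: le_trans (@gauge_norm_le _ _ _ _ _ _ _ hg n (incr k ^~ x) _) _.
    by rewrite /incr !stopped0 subrr.
  by rewrite ler_wpM2l//; exact: gam_incr_le.
- move=> n; apply: (gauge_sqr_le hg) => //.
    by apply: aeW => x; rewrite /incr !stopped0 subrr.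
  by move=> m; apply: filterS ae_levels_ok => x ok; exact: gam_incr_le.
Qed.

Definition bk (k : int) : T -> R := sval (cid (incr_closed k)).

Lemma bkP k : [/\ measurable_fun setT (bk k),
  P.-integrable setT (EFin \o bk k) &
  forall n, {ae P, forall x, E n (bk k) x = incr k n x}].
Proof. exact: svalP (cid (incr_closed k)). Qed.

Definition Lk (k : int) : R := fine (Lphi_norm P phi (indic_e (Bnu (nuk k)))).

(** The normalization under which the seminorm bound for [incr k] becomes the size condition of an
    atom. *)
Definition muk (k : int) : R := 3 * 2 ^ k * Lk k.

(* If [Lk k = 0] then [Bnu (nuk k)] is null, and [muk k] and [ak k] are both [0]. *)
Definition ak (k : int) (x : T) : R := (muk k)^-1 * bk k x.

Lemma Lk_ge0 k : 0 <= Lk k.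
Proof. by apply: fine_ge0; exact: Lphi_norm_ge0. Qed.

Lemma muk_ge0 k : 0 <= muk k.
Proof. by rewrite /muk !mulr_ge0 ?exprz_ge0 ?Lk_ge0. Qed.

Lemma condexp_ak k n : {ae P, forall x, E n (ak k) x = (muk k)^-1 * incr k n x}.
Proof.
have [_ ib bE] := bkP k.
by apply: filterS2 (condexpZ hF hE n (muk k)^-1 ib) (bE n) => x -> ->.
Qed.

Variable p : R.
Hypotheses (p0 : 0 < p) (lt_phi : lower_type phi p).

Lemma LkE k : Lphi_norm P phi (indic_e (Bnu (nuk k))) = (Lk k)%:E.
Proof. by rewrite /Lk fineK//; exact: Lphi_norm_indic_fin_num p0 lt_phi. Qed.

Lemma atom_ak k : atom P F E phi Top (ak k) (nuk k).
Proof.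
have [mb ib bE] := bkP k.
have aE : {ae P, forall x, forall n, E n (ak k) x = (muk k)^-1 * incr k n x}.
  by apply: ae_foralln => n; exact: condexp_ak.
split.
- by apply: measurable_funM => //.
- exact: integrable_EFinZ.
- exact: stopping_nuk.
- by move=> n; apply: filterS aE => x aEx nun; rewrite aEx incr_eq0// mulr0.
- apply: filterS2 aE ae_levels_ok => x aEx ok _.
  rewrite LkE; apply: (top_le_gauge hg) => n.
  have -> : (fun i => E i (ak k) x) = (fun i => (muk k)^-1 * incr k i x).
    by apply/funext => i; exact: aEx.
  rewrite (gaugeZ hg n _ (incr k ^~ x)) ger0_norm ?invr_ge0 ?muk_ge0//.
  (* The extended inverse of 0 is infinite, so a zero norm imposes no condition. *)
  rewrite inver; case: eqP => [_|/eqP L0]; first by rewrite leey.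
  have Lp : 0 < Lk k by rewrite lt_def L0 Lk_ge0.
  have kp : 0 < 3 * (2 : R) ^ k by rewrite mulr_gt0// exprz_gt0.
  rewrite lee_fin /muk invfM -mulrA mulrC -mulrA.
  rewrite -[leRHS]mulr1; apply: ler_wpM2l; first by rewrite invr_ge0 Lk_ge0.
  rewrite ler_pdivrMr// mul1r.
  exact: gam_incr_le.
Qed.

(** If [Lk k] is nonzero, [muk k] cancels. Otherwise both sides vanish off the null set
    [Bnu (nuk k)]. *)
Lemma muk_condexp_ak k n : {ae P, forall x, muk k * E n (ak k) x = incr k n x}.
Proof.
have [L0|L0] := eqVneq (Lk k) 0; last first.
  apply: filterS (condexp_ak k n) => x ->; rewrite mulrA divff ?mul1r//.
  by rewrite /muk !mulf_neq0 ?expfz_neq0 ?pnatr_eq0.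
have PB : P (Bnu (nuk k)) = 0%E.
  apply: (Lphi_norm_indic_eq0 hphi); last by rewrite LkE L0.
  exact: (measurable_Bnu hF (stopping_nuk k)).
exists (Bnu (nuk k)); split => //.
  exact: (measurable_Bnu hF (stopping_nuk k)).
move=> x /=; apply: contra_notP => nB.
by rewrite /muk L0 mulr0 mul0r incr_eq0//; exact: notin_Bnu_nu_ge.
Qed.

Lemma exists_atoms : exists a : int -> T -> R,
  (forall k, atom P F E phi Top (a k) (nuk k)) /\
  (forall k n, {ae P, forall x, muk k * E n (a k) x = incr k n x}).
Proof. by exists ak; split; [exact: atom_ak|exact: muk_condexp_ak]. Qed.

End stopping_construction.

(** * The modular estimate *)

Section modular_estimate.
Context {d : measure_display} {T : measurableType d} {R : realType}.
Variables (P : probability T R) (F : nat -> set (set T)).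
Variable E : nat -> (T -> R) -> T -> R.
Variable phi : T -> R -> R.
Hypotheses (hF : is_filtration F) (hE : is_condexp_op P F E).
Hypothesis hphi : MO_function P phi.
Variables (K Rc : R).
Hypotheses (K0 : 0 < K) (Rc0 : 0 < Rc).
Hypothesis hS : forall n t, 0 <= t ->
  {ae P, forall x, K^-1 * phi_n E phi n x t <= phi_n E phi n.+1 x t}.
Variables (p C : R).
Hypotheses (p0 : 0 < p) (C0 : 0 < C).
Hypothesis lt_phi : forall x t s, 0 <= t -> 0 < s < 1 ->
  phi x (s * t) <= C * s `^ p * phi x t.
Variables (Top : (nat -> T -> R) -> T -> \bar R) (gam : nat -> (nat -> R) -> R).
Hypothesis hg : gauge P F Top gam.
Variable f : nat -> T -> R.
Hypothesis hf : martingale0 P F E f.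
Variable lam : R.
Hypothesis lam0 : 0 < lam.
Hypothesis hlam : (\int[P]_x phie phi x (Top f x * (lam^-1)%:E) <= 1)%E.

Let fover := first_over gam f.
Let cov := cover E Rc gam f.

Definition tau (k : int) : set T := \bigcup_n cov (2 ^ k) n.
Definition rho (k : int) : set T := \bigcup_n fover (2 ^ k) n.+1.

Let mfover lev n : measurable (fover lev n).
Proof. exact: filtration_measurable hF _ _ (first_over_sub hF hg hf lev n). Qed.

Let mcov lev n : measurable (cov lev n).
Proof. exact: filtration_measurable hF _ _ (cover_sub hF hE Rc hg hf lev n). Qed.

Lemma measurable_tau k : measurable (tau k).
Proof. exact: bigcup_measurable. Qed.

Lemma measurable_rho k : measurable (rho k).
Proof. exact: bigcup_measurable. Qed.

Let lev0 k : 0 <= (2 : R) ^ k / lam.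
Proof. by rewrite divr_ge0 ?exprz_ge0// ltW. Qed.

Let phi0 x k : 0 <= phi x (2 ^ k / lam).
Proof. exact: (MO_ge0 hphi). Qed.

Let mphi k : measurable_fun setT (fun x => phi x (2 ^ k / lam)).
Proof. exact: (MO_measurable hphi). Qed.

Definition wk (A : int -> set T) (k : int) (x : T) : R :=
  phi x (2 ^ k / lam) * \1_(A k) x.

Lemma wk_ge0 A k x : 0 <= wk A k x.
Proof. by rewrite /wk mulr_ge0// indicE. Qed.

Lemma measurable_wk A k : measurable (A k) -> measurable_fun setT (EFin \o wk A k).
Proof.
by move=> mA; apply/measurable_EFinP; apply: measurable_funM => //; exact: measurable_indic.
Qed.

(** A union bound over the covers, then the estimate for a single cover. On the right no constant is
    lost, because the first passage events are disjoint. *)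
Lemma integral_tau_le k :
  (\int[P]_x (wk tau k x)%:E <= (Rc * K)%:E * \int[P]_x (wk rho k x)%:E)%E.
Proof.
have trivf : trivIset setT (fun n => fover (2 ^ k) n.+1).
  apply/trivIsetP => i j _ _ ij; rewrite -subset0 => x [] [gi hi] [gj hj].
  have [lij|lji|eij] := ltngtP i j; last by rewrite eij eqxx in ij.
    by have := hj i.+1 lij; rewrite leNgt gi.
  by have := hi j.+1 lji; rewrite leNgt gj.
pose u n x := phi x (2 ^ k / lam) * \1_(cov (2 ^ k) n) x.
have u0 n x : (0 <= (u n x)%:E)%E by rewrite lee_fin mulr_ge0// indicE.
have mu n : measurable_fun setT (fun x => (u n x)%:E).
  by apply/measurable_EFinP; apply: measurable_funM => //; exact: measurable_indic.
apply: (@le_trans _ _ (\int[P]_x (\sum_(n <oo) (u n x)%:E))%E).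
  apply: le_lower_integral => x; first by rewrite lee_fin wk_ge0.
  rewrite /wk indicE; case: (boolP (x \in tau k)) => [/set_mem[n _ cn]|_]; last first.
    by rewrite mulr0 nneseries_ge0.
  apply: (@le_trans _ _ (u n x)%:E).
    by rewrite lee_fin /u indicE mem_set.
  apply: (@le_trans _ _ (\sum_(0 <= i < n.+1) (u i x)%:E)%E); last exact: nneseries_lim_ge.
  by rewrite big_nat_recr//= leeDr// sume_ge0.
rewrite integral_nneseries//.
apply: (@le_trans _ _ (\sum_(n <oo)
    (Rc * K)%:E * \int[P]_(x in fover (2 ^ k) n.+1) (phi x (2 ^ k / lam))%:E)%E).
  apply: lee_nneseries => n _.
    by move=> _; apply: integral_ge0.
  rewrite -integral_set_indicM.
  exact: (integral_cover_le hF hE hphi K0 Rc0 hS hg hf).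
rewrite nneseriesZl//; last first.
  by move=> n _; apply: integral_ge0 => x _; rewrite lee_fin.
rewrite -ge0_integral_bigcup//.
- by rewrite -integral_set_indicM.
- by apply/measurable_EFinP; exact: measurable_funTS.
- by move=> x _; rewrite lee_fin.
Qed.

Lemma rho_lt_top k x : rho k x -> ((2 ^ k)%:E < Top f x)%E.
Proof.
move=> [n _ [gn _]]; apply: lt_le_trans (gauge_le_top hg n.+1 f x).
by rewrite lte_fin.
Qed.

Let Cp := C * geom_cst p.

Let Cp0 : 0 < Cp.
Proof. by rewrite mulr_gt0// geom_cst_gt0. Qed.

Let top0 x : (0 <= Top f x)%E.
Proof. by apply: le_trans (gauge_le_top hg 0 f x); rewrite lee_fin (gauge_ge0 hg). Qed.

(* By lower type [p], the terms decay geometrically below the largest [2 ^ k < Top f x]. *)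
Lemma sum_wk_rho_le (s : seq int) x : uniq s ->
  ((\sum_(k <- s) wk rho k x)%:E <= Cp%:E * phie phi x (Top f x * (lam^-1)%:E))%E.
Proof.
move=> us.
have li0 : 0 < lam^-1 by rewrite invr_gt0.
have := @rho_lt_top ^~ x; have := top0 x.
case: (Top f x) => [t| |] // t0 rhot; last first.
  by rewrite gt0_mulye ?lte_fin//= gt0_muley ?lte_fin// leey.
rewrite lee_fin in t0.
rewrite -EFinM /= lee_fin.
have -> : \sum_(k <- s) wk rho k x =
    \sum_(k <- [seq k <- s | x \in rho k]) phi x (2 ^ k / lam).
  rewrite big_filter [RHS]big_mkcond; apply: eq_bigr => k _.
  by rewrite /wk indicE; case: (_ \in _); rewrite ?mulr1 ?mulr0.
have rt k : k \in [seq k <- s | x \in rho k] -> 2 ^ k < t.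
  by rewrite mem_filter => /andP[/set_mem /rhot + _]; rewrite lte_fin.
set s' := [seq k <- s | x \in rho k] in rt *.
have [s'0|s'n0] := eqVneq s' [::].
  rewrite s'0 big_nil mulr_ge0 ?(ltW Cp0)// (MO_ge0 hphi)//.
  by rewrite divr_ge0// ltW.
have tp : 0 < t.
  case: s' s'n0 rt => // k s'' _ rt.
  by apply: le_lt_trans (rt k (mem_head _ _)); rewrite exprz_ge0.
have tpp : 0 < t `^ p by rewrite powR_gt0.
apply: (@le_trans _ _ (\sum_(k <- s') C * phi x (t / lam) / t `^ p * (2 ^ k) `^ p)).
  rewrite big_seq [leRHS]big_seq; apply: ler_sum => k ks.
  (* The ratio 2^k / t is below 1, and lower type extracts its p-th power. *)
  have -> : 2 ^ k / lam = (2 ^ k / t) * (t / lam).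
    by field; rewrite !gt_eqF.
  apply: le_trans (lt_phi x _ _) _.
  - by rewrite divr_ge0 ?ltW.
  - by rewrite divr_gt0 ?exprz_gt0//= ltr_pdivrMr// mul1r rt.
  - rewrite powRM ?exprz_ge0 ?invr_ge0 ?(ltW tp)//.
    rewrite -[t^-1]powR_inv1 ?(ltW tp)// -powRrM mulN1r powRN.
    by rewrite le_eqVlt; apply/orP; left; apply/eqP; ring.
rewrite -mulr_sumr.
have c0 : 0 <= C * phi x (t / lam) / t `^ p.
  by rewrite divr_ge0 ?mulr_ge0 ?powR_ge0 ?(ltW C0)// (MO_ge0 hphi)// divr_ge0// ltW.
apply: le_trans (ler_wpM2l c0 (geom_sum_seq_le p0 (ltW tp) _ _)) _.
- exact: filter_uniq.
- by move=> k /rt /ltW.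
- rewrite le_eqVlt; apply/orP; left; apply/eqP; rewrite /Cp.
  by field; rewrite gt_eqF.
Qed.

(* The sum of [wk A k x] over all integers [k], pairing [i] with [- i.+1]. *)
Definition Wsum (A : int -> set T) (x : T) : \bar R :=
  (\sum_(i <oo) (wk A (Posz i) x + wk A (Negz i) x)%:E)%E.

Lemma Wsum_term_ge0 A i x : (0 <= (wk A (Posz i) x + wk A (Negz i) x)%:E)%E.
Proof. by rewrite lee_fin addr_ge0 ?wk_ge0. Qed.

Lemma Wsum_ge0 A x : (0 <= Wsum A x)%E.
Proof. by apply: nneseries_ge0 => i _ _; exact: Wsum_term_ge0. Qed.

Lemma measurable_Wsum_term A i : (forall k, measurable (A k)) ->
  measurable_fun setT (fun x => (wk A (Posz i) x + wk A (Negz i) x)%:E).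
Proof.
move=> mA; have m1 := measurable_wk (mA (Posz i)); have m2 := measurable_wk (mA (Negz i)).
exact: emeasurable_funD m1 m2.
Qed.

Lemma measurable_Wsum A : (forall k, measurable (A k)) -> measurable_fun setT (Wsum A).
Proof.
move=> mA; apply: ge0_emeasurable_sum => [i x _ _|i _]; first exact: Wsum_term_ge0.
exact: measurable_Wsum_term.
Qed.

Lemma wk_le_Wsum A k x : ((wk A k x)%:E <= Wsum A x)%E.
Proof.
have term i : ((wk A (Posz i) x + wk A (Negz i) x)%:E <= Wsum A x)%E.
  apply: (@le_trans _ _ (\sum_(0 <= j < i.+1) (wk A (Posz j) x + wk A (Negz j) x)%:E)%E).
    by rewrite big_nat_recr//= leeDr// sume_ge0// => j _; exact: Wsum_term_ge0.
  by apply: nneseries_lim_ge => j _ _; exact: Wsum_term_ge0.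
case: k => i; apply: le_trans (term i); rewrite lee_fin.
  by rewrite lerDl wk_ge0.
by rewrite lerDr wk_ge0.
Qed.

Lemma Wsum_rho_le x :
  (Wsum rho x <= Cp%:E * phie phi x (Top f x * (lam^-1)%:E))%E.
Proof.
apply: lime_le.
  by apply: is_cvg_nneseries => i _ _; exact: Wsum_term_ge0.
apply: nearW => n.
pose s := [seq Posz i | i <- iota 0 n] ++ [seq Negz i | i <- iota 0 n].
have us : uniq s.
  rewrite cat_uniq !map_inj_uniq ?iota_uniq ?andbT//=; [|by move=> i j []|by move=> i j []].
  by apply/hasPn => _ /mapP[i _ ->]; apply/mapP => -[].
apply: le_trans (sum_wk_rho_le x us).
by rewrite sumEFin lee_fin /s big_cat !big_map big_split /= /index_iota subn0.
Qed.

(** The estimates of the single levels are summed; on the [rho] side the sum is dominated pointwise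
    by the modular of [Top f]. *)
Lemma integral_Wsum_tau_le : (\int[P]_x Wsum tau x <= (Rc * K * Cp)%:E)%E.
Proof.
have RK0 : 0 < Rc * K by rewrite mulr_gt0.
have mt := measurable_tau; have mr := measurable_rho.
apply: (@le_trans _ _ ((Rc * K)%:E * \int[P]_x Wsum rho x)%E).
  rewrite integral_nneseries//; [|by move=> i; exact: measurable_Wsum_term|
    by move=> i x _; exact: Wsum_term_ge0].
  rewrite [in leRHS]integral_nneseries//; [|by move=> i; exact: measurable_Wsum_term|
    by move=> i x _; exact: Wsum_term_ge0].
  rewrite -nneseriesZl//; last first.
    by move=> i _; apply: integral_ge0 => x _; exact: Wsum_term_ge0.
  apply: lee_nneseries => i _.
    by move=> _; apply: integral_ge0 => x _; exact: Wsum_term_ge0.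
  have w0 A k : forall x, setT x -> (0 <= (wk A k x)%:E)%E.
    by move=> x _; rewrite lee_fin wk_ge0.
  have splitE A : (forall k, measurable (A k)) ->
      (\int[P]_x (wk A (Posz i) x + wk A (Negz i) x)%:E =
       \int[P]_x (wk A (Posz i) x)%:E + \int[P]_x (wk A (Negz i) x)%:E)%E.
    move=> mA; under eq_integral do rewrite EFinD.
    rewrite ge0_integralD//; [exact: w0|exact: measurable_wk|exact: w0|exact: measurable_wk].
  rewrite !splitE// muleDr//.
  - by apply: leeD; exact: integral_tau_le.
  - by rewrite ge0_adde_def// inE; apply: integral_ge0; exact: w0.
rewrite [leRHS]EFinM lee_wpmul2l ?lee_fin ?(ltW RK0)//.
(* The constant is moved to the measurable function [Wsum rho], since the modular of [Top f] need
   not be measurable. *)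
have CpV : ((Cp^-1)%:E * \int[P]_x Wsum rho x <= 1)%E.
  rewrite -ge0_integralZl_EFin//; last 3 first.
  - by move=> x _; exact: Wsum_ge0.
  - exact: measurable_Wsum.
  - by rewrite invr_ge0 ltW.
  apply: le_trans hlam; apply: le_lower_integral => x.
    by rewrite mule_ge0 ?Wsum_ge0// lee_fin invr_ge0 ltW.
  apply: (@le_trans _ _ ((Cp^-1)%:E *
      (Cp%:E * phie phi x (Top f x * (lam^-1)%:E)))%E).
    by rewrite lee_wpmul2l ?lee_fin ?invr_ge0 ?(ltW Cp0)//; exact: Wsum_rho_le.
  by rewrite muleA -EFinM mulVf ?gt_eqF// mul1e.
by rewrite -[leLHS]mul1e -(divff (lt0r_neq0 Cp0)) EFinM -muleA -[leRHS]mule1 lee_wpmul2l ?lee_fin ?(ltW Cp0).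
Qed.

Lemma ae_Wsum_tau_fin_num : {ae P, forall x, Wsum tau x \is a fin_num}.
Proof.
have iW : P.-integrable setT (Wsum tau).
  apply/integrableP; split; first exact: measurable_Wsum measurable_tau.
  under eq_integral do rewrite gee0_abs ?Wsum_ge0//.
  by apply: le_lt_trans integral_Wsum_tau_le _; rewrite ltry.
by apply: filterS (integrable_ae measurableT iW) => x; exact.
Qed.

(** A level in [tau] contributes phi(x, 2^k / lam) to the sum, and this exceeds any finite value for
    large k. *)
Lemma tau_bounded x : Wsum tau x \is a fin_num ->
  exists N : nat, forall k, tau k x -> k <= N%:Z.
Proof.
move=> Wfin.
have /cvgryPgt/(_ (fine (Wsum tau x))) := MO_cvgy hphi x.
move=> [M [_ hM]].
pose N := Num.bound `|M * lam|.
have hN m : (N <= m)%N -> M * lam < 2 ^+ m.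
  move=> Nm; apply: le_lt_trans (ler_norm _) _.
  apply: lt_trans (archi_boundP (normr_ge0 _)) _.
  by rewrite -natrX ltr_nat; apply: leq_ltn_trans Nm _; exact: ltn_expl.
exists N => k tk; rewrite leNgt; apply/negP => Nk.
have k0 : 0 <= k by apply: le_trans (ltW Nk).
have ek : k = `|k|%N :> int by rewrite gez0_abs.
have Nk' : (N <= `|k|)%N by rewrite -lez_nat -ek ltW.
have := hM (2 ^ k / lam); rewrite ltr_pdivlMr// {1}ek.
move=> /(_ (hN _ Nk')); apply/negP; rewrite -leNgt.
rewrite -lee_fin fineK//; apply: le_trans (wk_le_Wsum tau k x).
by rewrite /wk indicE mem_set// mulr1.
Qed.

End modular_estimate.

(** * The atomic decomposition *)

Lemma le_sub_absz (N k : int) (i : nat) :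
  k <= N -> (i <= absz (N - k))%N -> k <= N - i%:Z.
Proof. lia. Qed.

Section atomic_lower_bound.
Context {d : measure_display} {T : measurableType d} {R : realType}.
Variables (P : probability T R) (F : nat -> set (set T)).
Variable E : nat -> (T -> R) -> T -> R.
Variable phi : T -> R -> R.
Hypotheses (hF : is_filtration F) (hE : is_condexp_op P F E).
Hypothesis hphi : MO_function P phi.
Variables (K Rc : R).
Hypotheses (K0 : 0 < K) (Rc0 : 0 < Rc).
Hypothesis hS : forall n t, 0 <= t ->
  {ae P, forall x, K^-1 * phi_n E phi n x t <= phi_n E phi n.+1 x t}.
Hypothesis hR : forall f : nat -> T -> R, martingale P F E f ->
  (forall n, {ae P, forall x, 0 <= f n x}) ->
  forall n, {ae P, forall x, f n.+1 x <= Rc * f n x}.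
Variables (p C : R).
Hypotheses (p0 : 0 < p) (C0 : 0 < C).
Hypothesis lt_phi : forall x t s, 0 <= t -> 0 < s < 1 ->
  phi x (s * t) <= C * s `^ p * phi x t.
Variables (Top : (nat -> T -> R) -> T -> \bar R) (gam : nat -> (nat -> R) -> R).
Hypothesis hg : gauge P F Top gam.

Let lt_phi' : lower_type phi p.
Proof. by exists C. Qed.

Section one_martingale.
Variable f : nat -> T -> R.
Hypothesis hf : martingale0 P F E f.
Variable lam : R.
Hypothesis lam0 : 0 < lam.
Hypothesis hlam : (\int[P]_x phie phi x (Top f x * (lam^-1)%:E) <= 1)%E.

Let nu := nuk E Rc gam f.
Let mu := muk P E phi Rc gam f.
Let L := Lk P E phi Rc gam f.
Let tau' := tau E Rc gam f.
Let W := Wsum phi lam tau'.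

Lemma Bnu_tau k x : Bnu (nu k) x <-> exists2 j, k <= j & tau' j x.
Proof.
split=> [/Bnu_hit[n [i _ ci]]|[j kj [n _ cn]]].
  by exists (k + i%:Z); [rewrite lerDl|exists n].
apply/Bnu_hit; exists n; exists (absz (j - k)) => //.
rewrite (_ : k + Posz _ = j)//; rewrite gez0_abs ?subr_ge0//; ring.
Qed.

Lemma ae_W_fin_num : {ae P, forall x, W x \is a fin_num}.
Proof. exact: (ae_Wsum_tau_fin_num hF hE hphi K0 Rc0 hS p0 C0 lt_phi hg hf lam0 hlam). Qed.

Lemma W_bounded x : W x \is a fin_num -> exists N : nat, forall k, tau' k x -> k <= N%:Z.
Proof. exact: (tau_bounded hphi lam0). Qed.

(** The symmetric partial sums telescope to [f] stopped at level N + 1 minus [f] stopped at level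
    -N. The first equals [f n] for large N, because high levels are not covered at x; the second is
    at most (n + 1) 2^(-N). *)
Lemma atomic_decomp_nuk (a : int -> T -> R) :
  (forall k, atom P F E phi Top (a k) (nu k)) ->
  (forall k n, {ae P, forall x, mu k * E n (a k) x = incr E Rc gam f k n x}) ->
  atomic_decomp P F E phi Top f mu a nu.
Proof.
move=> atoms aE; split => [k|//|n].
  exact: muk_ge0.
have aEk := ae_forall_int (fun k => aE k n).
apply: filterS3 (ae_levels_ok hF hE Rc0 hR hg hf) aEk ae_W_fin_num => x ok aEx Wfin.
have [N0 tauN] := W_bounded Wfin.
pose e N := stopped (nu (- N%:Z)) f n x.
have sumE N : \sum_(i < (2 * N).+1) mu (i%:Z - N%:Z) * E n (a (i%:Z - N%:Z)) x =
    stopped (nu (N%:Z + 1)) f n x - e N.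
  pose S (j : nat) := stopped (nu (j%:Z - N%:Z)) f n x.
  have -> : stopped (nu (N%:Z + 1)) f n x = S (2 * N).+1.
    by rewrite /S; congr (stopped (nu _) f n x); lia.
  have -> : e N = S 0%N by rewrite /e /S sub0r.
  rewrite -telescope_sumr// big_mkord; apply: eq_bigr => i _.
  by rewrite aEx /incr /S; congr (stopped (nuk _ _ _ _ _) f n x - _); lia.
have e0 : e N @[N --> \oo] --> 0.
  apply/norm_cvg0P.
  have half0 : n.+1%:R * (2^-1 : R) ^+ N @[N --> \oo] --> 0.
    rewrite -[X in _ --> X](mulr0 n.+1%:R); apply: cvgZl_tmp.
    apply: cvg_expr; rewrite ger0_norm// invf_lt1// ltr1n//.
  apply: (squeeze_cvgr _ (cvg_cst 0) half0); apply: nearW => N.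
  rewrite normr_ge0 /=.
  apply: le_trans (@gauge_norm_le _ _ _ _ _ _ _ hg n (stopped (nu (- N%:Z)) f ^~ x) _) _.
    by rewrite stopped0; exact: ok.1.
  apply: ler_wpM2l => //; apply: le_trans (gam_stopped_le hg _ n ok) _.
  by rewrite -exprz_inv exprnP.
have fe : f n x - e N @[N --> \oo] --> f n x.
  by rewrite -[X in _ --> X]subr0; apply: cvgB => //; exact: cvg_cst.
apply: cvg_trans fe; apply: near_eq_cvg.
exists N0 => // N /= N0N; rewrite sumE; congr (_ - _).
apply/esym/stopped_nu_ge; apply: notin_Bnu_nu_ge => /Bnu_tau[j Nj /tauN jN].
by have := le_trans Nj jN; lia.
Qed.

Lemma atomic_term_le k x :
  ((mu k)%:E * indic_e (Bnu (nu k)) x * (Lphi_norm P phi (indic_e (Bnu (nu k))))^-1 <=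
   (3 * 2 ^ k * \1_(Bnu (nu k)) x)%:E)%E.
Proof.
have -> : Lphi_norm P phi (indic_e (Bnu (nu k))) = (L k)%:E.
  by rewrite /L /Lk fineK//; exact: Lphi_norm_indic_fin_num p0 lt_phi'.
rewrite /indic_e /mu /muk -/(L k) inver.
have k0 : 0 <= 3 * (2 : R) ^ k * \1_(Bnu (nu k)) x.
  by rewrite !mulr_ge0 ?exprz_ge0// indicE.
(* With zero norm the coefficient is 0, and 0 times the infinite inverse is 0. *)
case: eqP => [->|/eqP L0]; first by rewrite mulr0 !mul0e lee_fin.
by rewrite -!EFinM lee_fin le_eqVlt; apply/orP; left; apply/eqP; field.
Qed.

Let V (r : R) x := ((\esum_(k in [set: int])
  (((mu k)%:E * indic_e (Bnu (nu k)) x *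
    (Lphi_norm P phi (indic_e (Bnu (nu k))))^-1) `^ r)) `^ (r^-1))%E.

(** Only levels [k <= k0] are active at [x], so the r-th powers form a geometric sum dominated by
    its top term. *)
Lemma atomic_sum_le (r : R) (k0 : int) x : 0 < r ->
  (forall k, tau' k x -> k <= k0) ->
  (V r x <= (3 * geom_cst r `^ (r^-1) * 2 ^ k0)%:E)%E.
Proof.
move=> r0 kmax.
have c0 := geom_cst_gt0 r0.
have q0 := mulr_ge0 (ltW c0) (powR_ge0 ((2 : R) ^ k0) r).
have y0 k : (0 <= (mu k)%:E * indic_e (Bnu (nu k)) x *
    (Lphi_norm P phi (indic_e (Bnu (nu k))))^-1)%E.
  rewrite !mule_ge0 ?lee_fin ?muk_ge0// ?indicE//.
  by rewrite inve_ge0 Lphi_norm_ge0.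
have -> : 3 * geom_cst r `^ (r^-1) * 2 ^ k0 =
    (3 `^ r * (geom_cst r * (2 ^ k0) `^ r)) `^ (r^-1).
  have k00 : 0 <= (2 : R) ^ k0 by rewrite exprz_ge0.
  rewrite (powRM _ (powR_ge0 _ _) q0) (powRM _ (ltW c0) (powR_ge0 _ _)).
  by rewrite -!powRrM !divff ?gt_eqF// !powRr1// mulrA.
rewrite -poweR_EFin; apply: gt0_ler_poweR.
- by rewrite invr_ge0 ltW.
- by rewrite in_itv /= leey esum_ge0// => k _; exact: poweR_ge0.
- by rewrite in_itv /= leey lee_fin andbT; exact: mulr_ge0 (powR_ge0 _ _) q0.
apply: ge_ereal_sup => _ [X [finX _] <-].
rewrite fsbig_finite//=.
pose s : seq int := fset_set X.
have us : uniq s by exact: fset_uniq.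
pose s' := [seq k <- s | x \in Bnu (nu k)].
apply: (@le_trans _ _ (\sum_(k <- s') 3 `^ r * (2 ^ k) `^ r)%:E).
  rewrite /s' big_filter [in leRHS]big_mkcond -sumEFin; apply: lee_sum => k _.
  apply: (@le_trans _ _ (((3 * 2 ^ k * \1_(Bnu (nu k)) x)%:E) `^ r)%E).
    apply: gt0_ler_poweR; first exact: ltW.
    - by rewrite in_itv /= leey y0.
    - by rewrite in_itv /= leey lee_fin !mulr_ge0 ?exprz_ge0// indicE.
    - exact: atomic_term_le.
  rewrite poweR_EFin indicE lee_fin; case: ifP => _.
    by rewrite mulr1 powRM// exprz_ge0.
  by rewrite mulr0 powR0// gt_eqF.
rewrite lee_fin -mulr_sumr; apply: ler_wpM2l; first exact: powR_ge0.
apply: geom_sum_seq_le => //.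
- by rewrite exprz_ge0.
- exact: filter_uniq.
- move=> k; rewrite mem_filter => /andP[/set_mem /Bnu_tau[j kj /kmax jk0] _].
  by apply: ler_weXz2l; [rewrite ler1n|exact: le_trans jk0].
Qed.

Lemma atomic_sum_eq0 (r : R) x : 0 < r -> (forall k, ~ tau' k x) -> V r x = 0%E.
Proof.
move=> r0 ntau; rewrite /V esum1 ?poweR0r ?gt_eqF ?invr_gt0// => k _.
rewrite /indic_e indicE memNset; last by move=> /Bnu_tau[j _ /ntau].
by rewrite mule0 mul0e poweR0r ?gt_eqF.
Qed.

Variable s : R.
Hypothesis s01 : 0 < s < 1.
Hypothesis hs : C * (Rc * K * (C * geom_cst p)) * s `^ p <= 1.

(** The numerator comes from the geometric sum of the atoms; dividing by [s] leaves a factor [s]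
    inside phi, through which lower type absorbs the modular constant. *)
Definition at_cst (r : R) : R := 3 * geom_cst r `^ (r^-1) / s.

Lemma at_cst_gt0 (r : R) : 0 < r -> 0 < at_cst r.
Proof.
move=> r0; have /andP[s0 _] := s01.
by rewrite divr_gt0// mulr_gt0// powR_gt0// geom_cst_gt0.
Qed.

Lemma phie_atomic_sum_le (r : R) x : 0 < r -> W x \is a fin_num ->
  (phie phi x (V r x * ((at_cst r * lam)^-1)%:E) <= (C * s `^ p)%:E * W x)%E.
Proof.
move=> r0 Wfin; have /andP[s0 s1] := s01.
have A0 := at_cst_gt0 r0.
have Al0 : 0 < at_cst r * lam by rewrite mulr_gt0.
have Csp0 : 0 <= C * s `^ p by rewrite mulr_ge0 ?powR_ge0// ltW.
have W0 : (0 <= W x)%E by exact: (Wsum_ge0 hphi lam0).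
have [[k1 tk1]|ntau] := pselect (exists k, tau' k x); last first.
  rewrite atomic_sum_eq0// => [|k tk]; last by apply: ntau; exists k.
  by rewrite mul0e /= (MO0 hphi) mule_ge0.
have [N tauN] := W_bounded Wfin.
(* The largest covered level is found by descending from the bound [N]: it is N - i for the least
   such i. *)
have exi : exists i : nat, `[< tau' (N%:Z - i%:Z) x >].
  exists (absz (N%:Z - k1)); apply/asboolP.
  by rewrite gez0_abs ?subr_ge0 ?tauN// opprB addrC subrK.
case: (ex_minnP exi) => i /asboolP ti imin.
pose k0 : int := N%:Z - i%:Z.
have kmax k : tau' k x -> k <= k0.
  move=> tk; have kN := tauN _ tk.
  have := imin (absz (N%:Z - k)); rewrite gez0_abs ?subr_ge0//.
  rewrite opprB [N%:Z + _]addrC subrK => /(_ (asboolT tk)).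
  exact: le_sub_absz.
apply: (@le_trans _ _ (phie phi x ((3 * geom_cst r `^ (r^-1) * 2 ^ k0)%:E *
    ((at_cst r * lam)^-1)%:E))%E).
  apply: (phie_le hphi).
    by rewrite mule_ge0 ?poweR_ge0// lee_fin invr_ge0 ltW.
  by rewrite lee_wpmul2r ?lee_fin ?invr_ge0 ?(ltW Al0)//; exact: atomic_sum_le.
have g0 : geom_cst r `^ (r^-1) != 0.
  by rewrite gt_eqF// powR_gt0// geom_cst_gt0.
rewrite -EFinM (_ : _ / _ = s * (2 ^ k0 / lam)); last first.
  by rewrite /at_cst; field; rewrite g0 !gt_eqF.
(* The largest level alone controls the atomic sum, so a single term of [W] suffices. *)
apply: (@le_trans _ _ ((C * s `^ p) * wk phi lam tau' k0 x)%:E).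
  rewrite /wk indicE mem_set// mulr1 /= lee_fin; apply: lt_phi => //.
  by rewrite divr_ge0 ?exprz_ge0// ltW.
rewrite EFinM lee_wpmul2l ?lee_fin//.
exact: (wk_le_Wsum hphi lam0).
Qed.

Lemma atomic_value_le (r : R) : 0 < r ->
  (atomic_value P phi r mu nu <= (at_cst r * lam)%:E)%E.
Proof.
move=> r0; have A0 := at_cst_gt0 r0; have /andP[s0 s1] := s01.
have Csp0 : 0 <= C * s `^ p by rewrite mulr_ge0 ?powR_ge0// ltW.
apply: ereal_inf_lbound; exists (at_cst r * lam) => //; split.
  by rewrite mulr_gt0.
have W0 x : (0 <= W x)%E by exact: (Wsum_ge0 hphi lam0).
apply: (@le_trans _ _ (\int[P]_x ((C * s `^ p)%:E * W x))%E).
  apply: ae_le_lower_integral.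
  - move=> x; apply: (phie_ge0 hphi); rewrite mule_ge0 ?poweR_ge0//.
    by rewrite lee_fin invr_ge0 ltW// mulr_gt0.
  - by move=> x; rewrite mule_ge0.
  - by apply: filterS ae_W_fin_num => x; exact: phie_atomic_sum_le.
rewrite ge0_integralZl_EFin//; last first.
  apply: (measurable_Wsum hphi lam0).
  exact: (measurable_tau hF hE Rc hg hf).
apply: (@le_trans _ _ ((C * s `^ p)%:E * (Rc * K * (C * geom_cst p))%:E)%E).
  rewrite lee_wpmul2l ?lee_fin//.
  exact: (integral_Wsum_tau_le hF hE hphi K0 Rc0 hS p0 C0 lt_phi hg hf lam0 hlam).
by rewrite -EFinM lee_fin mulrAC.
Qed.

Lemma at_norm_le_lam (r : R) : 0 < r ->
  (at_norm P F E phi Top r f <= (at_cst r * lam)%:E)%E.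
Proof.
move=> r0; apply: le_trans (atomic_value_le r0).
have [a [atoms aE]] := exists_atoms hF hE hphi Rc0 hR hg hf p0 lt_phi'.
apply: ereal_inf_lbound; exists mu, a, nu; split => //.
exact: atomic_decomp_nuk.
Qed.

End one_martingale.

(** The scale [s] depends only on [C], [K], [Rc] and [p], so the constant is uniform in [f] and
    [lam], and the infimum over admissible [lam] can be taken. *)
Lemma at_norm_le_Lphi_norm (r : R) : 0 < r -> exists2 A : R, 0 < A &
  forall f, martingale0 P F E f ->
    (at_norm P F E phi Top r f <= A%:E * Lphi_norm P phi (Top f))%E.
Proof.
move=> r0.
have c0 : 0 <= C * (Rc * K * (C * geom_cst p)).
  exact: ltW (mulr_gt0 C0 (mulr_gt0 (mulr_gt0 Rc0 K0) (mulr_gt0 C0 (geom_cst_gt0 p0)))).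
have [s s01 hs] := exists_scale_le1 p0 c0.
exists (at_cst s r); first exact: at_cst_gt0.
move=> f hf; have A0 := at_cst_gt0 s01 r0.
rewrite -lee_pdivrMl//; apply: le_ereal_inf_tmp => _ [lam [lam0 hlam] <-].
rewrite lee_pdivrMl// -EFinM.
exact: (at_norm_le_lam hf lam0 hlam s01 hs).
Qed.

Lemma atomic_equivalence (r : R) : 0 < r <= 1 -> exists A : R, 0 < A /\
  forall f, martingale0 P F E f ->
    [/\ (Lphi_norm P phi (Top f) < +oo <-> at_norm P F E phi Top r f < +oo)%E,
        (Lphi_norm P phi (Top f) <= A%:E * at_norm P F E phi Top r f)%E &
        (at_norm P F E phi Top r f <= A%:E * Lphi_norm P phi (Top f))%E].
Proof.
move=> hr; have /andP[r0 r1] := hr.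
have [A A0 hA] := at_norm_le_Lphi_norm r0.
have up f := Lphi_norm_le_at_norm E hphi f hg hr.
exists (Num.max 1 A); split; first by rewrite lt_max ltr01.
move=> f hf; have N0 := Lphi_norm_ge0 P phi (Top f).
have at0 : (0 <= at_norm P F E phi Top r f)%E by exact: le_trans (up f).
split.
- split=> [Nfin|]; last exact: le_lt_trans.
  by apply: le_lt_trans (hA f hf) _; rewrite lte_mul_pinfty// lee_fin ltW.
- apply: le_trans (up f) _; rewrite -[leLHS]mul1e lee_wpmul2r// lee_fin.
  by rewrite le_max lexx.
- apply: le_trans (hA f hf) _; rewrite lee_wpmul2r// lee_fin.
  by rewrite le_max lexx orbT.
Qed.

End atomic_lower_bound.

Theorem theorem4p6 (d : measure_display) (T : measurableType d) (R : realType)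
    (P : probability T R) (F : nat -> set (set T))
    (E : nat -> (T -> R) -> T -> R) (phi : T -> R -> R) (p : R) :
  is_filtration F -> is_condexp_op P F E ->
  MO_function P phi -> 0 < p -> lower_type phi p ->
  S_minus P E phi -> regular P F E ->
  forall r : R, 0 < r <= 1 ->
  (exists C : R, 0 < C /\
     forall f : nat -> T -> R, martingale0 P F E f ->
       [/\ (Lphi_norm P phi (Mf f) < +oo <-> at_norm P F E phi Mf r f < +oo)%E,
           (Lphi_norm P phi (Mf f) <= C%:E * at_norm P F E phi Mf r f)%E &
           (at_norm P F E phi Mf r f <= C%:E * Lphi_norm P phi (Mf f))%E]) /\
  (exists C : R, 0 < C /\
     forall f : nat -> T -> R, martingale0 P F E f ->
       [/\ (Lphi_norm P phi (Sf f) < +oo <-> at_norm P F E phi Sf r f < +oo)%E,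
           (Lphi_norm P phi (Sf f) <= C%:E * at_norm P F E phi Sf r f)%E &
           (at_norm P F E phi Sf r f <= C%:E * Lphi_norm P phi (Sf f))%E]).
Proof.
move=> hF hE hphi p0 [C [C0 lt_phi]] [K [K0 hS]] [Rc [Rc0 hR]] r hr.
split.
- exact: (atomic_equivalence hF hE hphi K0 Rc0 hS hR p0 C0 lt_phi (gauge_Mf P hF) hr).
- exact: (atomic_equivalence hF hE hphi K0 Rc0 hS hR p0 C0 lt_phi (gauge_Sf P hF) hr).
Qed.
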